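(* Let $U\subseteq\mathbb{R}^3$ be open and let $f:U\to\mathbb{R}$ be smooth with $X=0$ and $Y>0$ on $U$. Then, locally, $f$ admits a smooth conjugate (that is, every point of $U$ has an open neighbourhood on which there is a smooth conjugate function of $f$) if and only if $V\equiv0$ and $$\tfrac{25}{14}N+\tfrac{3}{5}G+\tfrac{3}{4}F+\tfrac{1}{21}T-\tfrac{17}{21}ZK-\tfrac{7}{9}ZA=0$$ on $U$.
   Context: Indices run over $1,2,3$ and refer to standard coordinates on $\mathbb{R}^3$; they are raised and lowered with the Euclidean metric $\delta_{ij}$ and repeated indices are summed. $\nabla_i$ is the flat connection, $f_i=\nabla_if$, $f_{ij}=\nabla_i\nabla_jf$, $f_{ijk}=\nabla_i\nabla_j\nabla_kf$. Round brackets denote symmetrisation over the enclosed free indices (with the factor $1/n!$). $\epsilon^{ijk}$ is a volume form on $\mathbb{R}^3$, normalised up to sign by $\epsilon^{ijk}\epsilon_{ijk}=6$. Two smooth real functions $f,g$ are conjugate if $\|\nabla f\|=\|\nabla g\|$ and $\langle\nabla f,\nabla g\rangle=0$. Define $$J=f^if_i,\qquad Z=f^{ij}f_if_j+Jf^j{}_j,\qquad X=2f_i{}^jf_jf^{ik}f_k-Jf^{jk}f_{jk}+J(f^j{}_j)^2,\qquad Y=Z^2-2JX,$$ $$\sigma_i=J\nabla_iZ-2Z\nabla_iJ,$$ $$\phi_{ij}=Jf_{ij}-2f_{(i}f_{j)}{}^kf_k-\tfrac13Jf^k{}_k\delta_{ij}+\tfrac23f^{kl}f_kf_l\delta_{ij},$$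 $$\rho_{ijk}=J\nabla_{(i}\phi_{jk)}-3\phi_{(ij}\nabla_{k)}J-\tfrac25J\delta_{(ij}\nabla^l\phi_{k)l}+\tfrac65\delta_{(ij}\phi_{k)l}\nabla^lJ,$$ $$\lambda_j=2J\nabla^i\phi_{ij}-\phi_{ij}\nabla^iJ,$$ $$A=\sigma^i\sigma_i,\quad T=\phi^{ij}\sigma_i\sigma_j,\quad F=\rho^{ijk}\phi_{ij}\lambda_k,\quad G=\phi^{ij}\lambda_i\lambda_j,\quad K=\sigma^i\lambda_i,\quad N=\sigma_i\rho^{ijk}\phi_{jk}.$$ Finally, with $Q^{ij}=f^{ijk}f_k-2f^{ik}f_k{}^j$, $$V=4J\,\epsilon^{jkl}\bigl(Jf_k{}^iQ_{ij}-f^iQ_{ij}f_{km}f^m\bigr)f_l .$$ *)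

(* Defs.v *)
From HB Require Import structures.
From mathcomp Require Import all_boot all_order all_algebra.
From mathcomp Require Import all_classical all_reals all_analysis.
Import Order.TTheory GRing.Theory Num.Theory.
Import numFieldNormedType.Exports.

Set Implicit Arguments.
Unset Strict Implicit.
Unset Printing Implicit Defensive.

Local Open Scope classical_set_scope.
Local Open Scope ring_scope.

(* Points of R^3 are row vectors 'rV[R]_3.  Functions
   on an open set U are total functions; everything below is only evaluated at
   points of U, where derivatives depend only on the restriction to U.
   Indices are raised and lowered with the Euclidean metric, so their position
   is immaterial and they are all written as plain arguments. *)

Section calculus.
Context {R : realType}.
Implicit Types (U W : set 'rV[R]_3) (f g : 'rV[R]_3 -> R) (x : 'rV[R]_3).

Definition nabla (i : 'I_3) f : 'rV[R]_3 -> R :=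
  fun x => 'D_(delta_mx 0 i) f x.

(* nabla_iter [:: i1; ...; ik] f = nabla_i1 (... (nabla_ik f)) *)
Definition nabla_iter (s : seq 'I_3) f : 'rV[R]_3 -> R := foldr nabla f s.

(* All iterated partial derivatives exist and are continuous on the open
   set U. *)
Definition smooth_on U f : Prop :=
  forall (s : seq 'I_3) x, U x ->
    {for x, continuous (nabla_iter s f)} /\
    forall i : 'I_3, derivable (nabla_iter s f) x (delta_mx 0 i).

Definition grad f x : 'rV[R]_3 := \row_i nabla i f x.

Definition dot (u v : 'rV[R]_3) : R := \sum_i u 0 i * v 0 i.

(* The library norm `|u| on 'rV[R]_3 is the sup norm, not this one. *)
Definition enorm (u : 'rV[R]_3) : R := Num.sqrt (dot u u).

Definition conjugate_on W f g : Prop :=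
  forall x, W x ->
    enorm (grad f x) = enorm (grad g x) /\ dot (grad f x) (grad g x) = 0.

Definition locally_has_smooth_conjugate U f : Prop :=
  forall p, U p ->
    exists (W : set 'rV[R]_3) (g : 'rV[R]_3 -> R),
      [/\ open W, W p, W `<=` U, smooth_on W g & conjugate_on W f g].

(* A smooth 3-form, given by its components, normalised by
   eps^{ijk} eps_{ijk} = 6; this determines it up to sign. *)
Definition normalised_volume_form
    (eps : 'rV[R]_3 -> 'I_3 -> 'I_3 -> 'I_3 -> R) : Prop :=
  [/\ forall i j k, smooth_on setT (fun x => eps x i j k),
      forall x i j k, eps x j i k = - eps x i j k,
      forall x i j k, eps x i k j = - eps x i j k
    & forall x, \sum_i \sum_j \sum_k eps x i j k * eps x i j k = 6].

Definition kron (i j : 'I_3) : R := (i == j)%:R.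

Definition sym2 (t : 'I_3 -> 'I_3 -> R) (i j : 'I_3) : R :=
  (t i j + t j i) / 2.

Definition sym3 (t : 'I_3 -> 'I_3 -> 'I_3 -> R) (i j k : 'I_3) : R :=
  (t i j k + t i k j + t j i k + t j k i + t k i j + t k j i) / 6.

End calculus.

Section invariants.
Context {R : realType}.
Variable f : 'rV[R]_3 -> R.
Implicit Types (x : 'rV[R]_3) (i j k : 'I_3).

Definition d1 i : 'rV[R]_3 -> R := nabla i f.
Definition d2 i j : 'rV[R]_3 -> R := nabla i (nabla j f).
Definition d3 i j k : 'rV[R]_3 -> R := nabla i (nabla j (nabla k f)).

Definition lap x : R := \sum_j d2 j j x.

Definition scalJ x : R := \sum_i d1 i x * d1 i x.

Definition scalZ x : R :=
  (\sum_i \sum_j d2 i j x * d1 i x * d1 j x) + scalJ x * lap x.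

Definition scalX x : R :=
  2 * (\sum_i \sum_j \sum_k d2 i j x * d1 j x * d2 i k x * d1 k x)
  - scalJ x * (\sum_j \sum_k d2 j k x * d2 j k x)
  + scalJ x * lap x ^+ 2.

Definition scalY x : R := scalZ x ^+ 2 - 2 * scalJ x * scalX x.

Definition sigma i x : R :=
  scalJ x * nabla i scalZ x - 2 * scalZ x * nabla i scalJ x.

Definition phi i j x : R :=
  scalJ x * d2 i j x
  - 2 * sym2 (fun a b => \sum_k d1 a x * d2 b k x * d1 k x) i j
  - 1 / 3 * scalJ x * lap x * kron i j
  + 2 / 3 * (\sum_k \sum_l d2 k l x * d1 k x * d1 l x) * kron i j.

Definition rho i j k x : R :=
  scalJ x * sym3 (fun a b c => nabla a (phi b c) x) i j k
  - 3 * sym3 (fun a b c => phi a b x * nabla c scalJ x) i j k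
  - 2 / 5 * scalJ x
      * sym3 (fun a b c => kron a b * \sum_l nabla l (phi c l) x) i j k
  + 6 / 5
      * sym3 (fun a b c => kron a b * \sum_l phi c l x * nabla l scalJ x) i j k.

Definition lambda j x : R :=
  2 * scalJ x * (\sum_i nabla i (phi i j) x)
  - \sum_i phi i j x * nabla i scalJ x.

Definition scalA x : R := \sum_i sigma i x * sigma i x.

Definition scalT x : R := \sum_i \sum_j phi i j x * sigma i x * sigma j x.

Definition scalF x : R :=
  \sum_i \sum_j \sum_k rho i j k x * phi i j x * lambda k x.

Definition scalG x : R := \sum_i \sum_j phi i j x * lambda i x * lambda j x.

Definition scalK x : R := \sum_i sigma i x * lambda i x.

Definition scalN x : R :=
  \sum_i \sum_j \sum_k sigma i x * rho i j k x * phi j k x.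

Definition tensQ i j x : R :=
  (\sum_k d3 i j k x * d1 k x) - 2 * (\sum_k d2 i k x * d2 k j x).

Definition scalV (eps : 'rV[R]_3 -> 'I_3 -> 'I_3 -> 'I_3 -> R) x : R :=
  4 * scalJ x *
  \sum_j \sum_k \sum_l
    eps x j k l
    * (scalJ x * (\sum_i d2 k i x * tensQ i j x)
       - (\sum_i d1 i x * tensQ i j x) * (\sum_m d2 k m x * d1 m x))
    * d1 l x.

End invariants.

(* Main.v *)
Require Import Defs.
From mathcomp Require Import all_boot all_order all_algebra.
From mathcomp Require Import all_classical all_reals all_analysis.
From mathcomp Require Import ring lra.
Import Order.TTheory GRing.Theory Num.Theory.
Import numFieldNormedType.Exports.
Set Implicit Arguments.
Unset Strict Implicit.
Unset Printing Implicit Defensive.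
Local Open Scope classical_set_scope.
Local Open Scope ring_scope.

(** Write p for the gradient and H for the Hessian of f, so that J = p.p, and
    put a = H(p,p).  Differentiating p.w = 0 and w.w = J, where w is the
    gradient of a conjugate g, and using that the Hessian of g is symmetric,
    gives the algebraic condition H(w,w) = -a.  Hence w is a null vector of
    the quadratic form H + (a/J) on the plane orthogonal to p.  As a tensor of
    rank two on R^3 that form, multiplied by J, is jL; it has trace Z and its
    determinant on the plane is J X / 2.  So when X = 0 and Y = Z^2 > 0 it has
    rank exactly one: its null line is a smooth line field, and w is
    determined up to sign by w.w = J (jLw_eq0, jkernel).  The function f
    therefore has a conjugate near a point exactly when this explicit 1-form w
    is closed, by Schwarz's theorem (nabla_nablaC) in one direction and the
    Poincare lemma (poincare) in the other.

    It remains to see that dw = 0 is equivalent to the two scalar equations.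
    At a fixed point this is algebra in the third-order jet of f and the
    first-order jet of w (closed_iff).  In the orthonormal frame with first
    vectors p/|p| and w/|w| the second-order jet has four free components al,
    b, c, z, and the derivatives of X = 0 fix three third derivatives.
    Differentiating p.w = 0 and w.w = J determines all of the derivative of w
    except its third component, which comes from differentiating jL w = 0.
    One component of dw vanishes identically; the two others vanish if and
    only if, after scaling |p| to 1, c123 = 2 b c and c223 + c (al + z) = 0.
    On the other hand V is a nonzero multiple of c123 - 2 b c (frame_V), and
    the combination of N, G, F, T, ZK and ZA is z (c223 + c (al + z))^2 up to
    a power of |p| (frame_E).

    The invariants are defined in the standard coordinates, so the passage to
    the adapted frame needs that they do not depend on the orthonormal frame;
    this is proved compositionally, by relations between the components of a
    tensor in two frames that all tensor operations preserve (rel1, rel2,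
    rel3). *)

(** * Tensor components in an orthonormal frame *)

Section rotation.
Context {R : realType}.
Variable O : 'M[R]_3.
Hypothesis Oorth : O *m O^T = 1%:M.
Implicit Types (u v : 'I_3 -> R) (s t : 'I_3 -> 'I_3 -> R)
  (q r : 'I_3 -> 'I_3 -> 'I_3 -> R).

Definition rotate u : 'I_3 -> R := fun i => \sum_a O a i * u a.

Lemma eq_rot u v i : u =1 v -> rotate u i = rotate v i.
Proof. by move=> e; apply: eq_bigr => a _; rewrite e. Qed.

Lemma rotD u v i : rotate u i + rotate v i = rotate (fun a => u a + v a) i.
Proof. by rewrite /rotate -big_split; apply: eq_bigr => a _;
  rewrite mulrDr. Qed.

Lemma rotN u i : - rotate u i = rotate (fun a => - u a) i.
Proof. by rewrite /rotate -sumrN; apply: eq_bigr => a _; rewrite mulrN. Qed.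

Lemma rotZ c u i : c * rotate u i = rotate (fun a => c * u a) i.
Proof. by rewrite /rotate mulr_sumr; apply: eq_bigr => a _; rewrite mulrCA. Qed.

Lemma rot_sum (F : 'I_3 -> 'I_3 -> R) i :
  \sum_j rotate (F j) i = rotate (fun a => \sum_j F j a) i.
Proof.
by rewrite exchange_big; apply: eq_bigr => a _; rewrite mulr_sumr.
Qed.

Lemma rotC (F : 'I_3 -> 'I_3 -> R) i j :
  rotate (fun a => rotate (F a) j) i = rotate (fun b => rotate (F^~ b) i) j.
Proof.
rewrite /rotate; under eq_bigr do rewrite mulr_sumr.
rewrite exchange_big; apply: eq_bigr => a _; rewrite mulr_sumr.
by apply: eq_bigr => b _; rewrite mulrCA.
Qed.

Lemma orthonormal_rows a b : \sum_i O a i * O b i = kron a b.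
Proof.
move/matrixP: Oorth => /(_ a b); rewrite mxE [RHS]mxE /kron => <-.
by apply: eq_bigr => i _; rewrite mxE.
Qed.

Lemma orthonormal_cols i j : \sum_a O a i * O a j = kron i j.
Proof.
have /matrixP/(_ i j) : O^T *m O = 1%:M by exact: mulmx1C.
by rewrite mxE [RHS]mxE /kron => <-; apply: eq_bigr => a _; rewrite mxE.
Qed.

Lemma sum_kron u i : \sum_j kron i j * u j = u i.
Proof.
rewrite (bigD1 i) //= /kron eqxx mul1r big1 ?addr0 // => j ji.
by rewrite eq_sym (negPf ji) mul0r.
Qed.

Lemma rot_dot u v : \sum_i rotate u i * rotate v i = \sum_a u a * v a.
Proof.
transitivity (\sum_i \sum_a \sum_b (O a i * O b i) * (u a * v b)).
  apply: eq_bigr => i _; rewrite mulr_suml; apply: eq_bigr => a _.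
  by rewrite mulr_sumr; apply: eq_bigr => b _; rewrite mulrACA.
rewrite exchange_big; apply: eq_bigr => a _; rewrite exchange_big /=.
under eq_bigr do rewrite -mulr_suml orthonormal_rows mulrCA.
by rewrite -mulr_sumr sum_kron.
Qed.

(** The primed tensor consists of the components of the unprimed one in the
    frame formed by the rows of O.  The unprimed components are the ones
    expressed through the primed ones, so that an equation proved in the frame
    transfers back by rewriting. *)
Definition rel1 u u' := forall i, u i = rotate u' i.
Definition rel2 t t' := forall i j, t i j = rotate (fun a => rotate (t' a) j) i.
Definition rel3 q q' :=
  forall i j k, q i j k = rotate (fun a => rotate (fun b => rotate
    (q' a b) k) j) i.

(** The rows of O are orthonormal, so contracting with O undoes rotate. *)
Lemma rel1_inv u u' : rel1 u u' -> forall a, u' a = \sum_i O a i * u i.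
Proof.
move=> h a; under eq_bigr do rewrite h mulr_sumr.
rewrite exchange_big /=; under eq_bigr.
  move=> b _; under eq_bigr do rewrite mulrA.
  rewrite -mulr_suml orthonormal_rows; over.
by rewrite sum_kron.
Qed.

Lemma rel1_exists u : exists u', rel1 u u'.
Proof.
exists (fun a => \sum_i O a i * u i) => i; rewrite /rotate.
under eq_bigr do rewrite mulr_sumr.
rewrite exchange_big /=; under eq_bigr.
  move=> j _; under eq_bigr do rewrite mulrA.
  rewrite -mulr_suml orthonormal_cols; over.
by rewrite sum_kron.
Qed.

Lemma rel2_exists t : exists t', rel2 t t'.
Proof.
have [/= t1 h1] := choice (fun i => rel1_exists (t i)).
have [/= t2 h2] := choice (fun a => rel1_exists (t1^~ a)).
exists (fun b a => t2 a b) => i j; rewrite h1 rotC.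
by apply: eq_rot => a; rewrite h2.
Qed.

Lemma rel3_exists q : exists q', rel3 q q'.
Proof.
have [/= t1 h1] := choice (fun i => rel2_exists (q i)).
have [/= t2 h2] := choice (fun a : 'I_3 * 'I_3 =>
  rel1_exists (fun i => t1 i a.1 a.2)).
exists (fun c a b => t2 (a, b) c) => i j k; rewrite h1.
transitivity (rotate (fun a => rotate (fun b => rotate (t2 (a, b)) i) k) j).
  by apply: eq_rot => a; apply: eq_rot => b; exact: (h2 (a, b) i).
rewrite rotC; transitivity (rotate (fun a => rotate (fun c =>
  rotate (fun b => t2 (a, b) c) k) i) j).
  by rewrite rotC; apply: eq_rot => a; rewrite rotC.
by rewrite rotC.
Qed.

Lemma rel1_eq0 u u' : rel1 u u' -> (forall i, u i = 0) -> forall a, u' a = 0.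
Proof. by move=> h e a; rewrite (rel1_inv h) big1 // => i _;
  rewrite e mulr0. Qed.

(** With the first index frozen at its standard value, the remaining index
    still transforms as that of a vector.  Every contraction is reduced to
    vectors in this way. *)
Lemma rel2_row t t' i : rel2 t t' -> rel1 (t i) (fun b => rotate (t'^~ b) i).
Proof. by move=> h j; rewrite h rotC. Qed.

Lemma rel2_inj s t t' : rel2 s t -> rel2 s t' -> forall a b, t a b = t' a b.
Proof.
move=> h h' a b.
have e i : rotate (t^~ b) i = rotate (t'^~ b) i.
  by rewrite (rel1_inv (rel2_row i h)) (rel1_inv (rel2_row i h')).
have -> := @rel1_inv (rotate (t^~ b)) (t^~ b) (fun=> erefl) a.
have -> := @rel1_inv (rotate (t'^~ b)) (t'^~ b) (fun=> erefl) a.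
by under eq_bigr do rewrite e.
Qed.

Lemma rel3_inj q r r' :
  rel3 q r -> rel3 q r' -> forall a b c, r a b c = r' a b c.
Proof.
move=> h h' a b c.
have e i : rotate (fun a => r a b c) i = rotate (fun a => r' a b c) i.
  apply: (@rel2_inj (q i)
     (fun b c => rotate (fun a => r a b c) i) (fun b c => rotate (fun a =>
       r' a b c) i)).
    move=> j k; rewrite h rotC; apply: eq_rot => b'; exact: rotC.
  move=> j k; rewrite h' rotC; apply: eq_rot => b'; exact: rotC.
have -> := @rel1_inv (rotate (fun a => r a b c)) (fun a => r a b c)
  (fun=> erefl) a.
have -> := @rel1_inv (rotate (fun a => r' a b c)) (fun a => r' a b c)
  (fun=> erefl) a.
by under eq_bigr do rewrite e.
Qed.

Lemma rel2_eq0 t t' :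
  rel2 t t' -> (forall i j, t i j = 0) -> forall a b, t' a b = 0.
Proof.
move=> h e; apply: (rel2_inj h) => i j; rewrite e.
by rewrite /rotate big1 // => a _; rewrite big1 ?mulr0 // => b _; rewrite mulr0.
Qed.

Lemma rel1_add u u' v v' : rel1 u u' -> rel1 v v' ->
  rel1 (fun i => u i + v i) (fun a => u' a + v' a).
Proof. by move=> h k i; rewrite h k rotD. Qed.

Lemma rel1_opp u u' : rel1 u u' -> rel1 (fun i => - u i) (fun a => - u' a).
Proof. by move=> h i; rewrite h rotN. Qed.

Lemma rel1_scale c c' u u' : c = c' -> rel1 u u' ->
  rel1 (fun i => c * u i) (fun a => c' * u' a).
Proof. by move=> -> h i; rewrite h rotZ. Qed.

Lemma rel2_add t t' s s' : rel2 t t' -> rel2 s s' ->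
  rel2 (fun i j => t i j + s i j) (fun a b => t' a b + s' a b).
Proof.
by move=> h k i j; rewrite h k rotD; apply: eq_rot => a; rewrite rotD.
Qed.

Lemma rel2_opp t t' : rel2 t t' ->
  rel2 (fun i j => - t i j) (fun a b => - t' a b).
Proof. by move=> h i j; rewrite h rotN; apply: eq_rot => a; rewrite rotN. Qed.

Lemma rel2_scale c c' t t' : c = c' -> rel2 t t' ->
  rel2 (fun i j => c * t i j) (fun a b => c' * t' a b).
Proof.
by move=> -> h i j; rewrite h rotZ; apply: eq_rot => a; rewrite rotZ.
Qed.

Lemma rel2_tr t t' : rel2 t t' ->
  rel2 (fun i j => t j i) (fun a b => t' b a).
Proof. by move=> h i j; rewrite h rotC. Qed.

Lemma rel2_outer u u' v v' : rel1 u u' -> rel1 v v' ->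
  rel2 (fun i j => u i * v j) (fun a b => u' a * v' b).
Proof.
move=> h k i j; rewrite h k mulrC rotZ; apply: eq_rot => a.
by rewrite mulrC rotZ.
Qed.

(** The columns of O are orthonormal too. *)
Lemma rel2_kron : rel2 kron kron.
Proof.
move=> i j; rewrite -orthonormal_cols; apply: eq_bigr => a _; congr (_ * _).
by rewrite /rotate; under eq_bigr do rewrite mulrC; rewrite sum_kron.
Qed.

Lemma rel3_add q q' r r' : rel3 q q' -> rel3 r r' ->
  rel3 (fun i j k => q i j k + r i j k) (fun a b c => q' a b c + r' a b c).
Proof.
move=> h k i j l; rewrite h k rotD; apply: eq_rot => a; rewrite rotD.
by apply: eq_rot => b; rewrite rotD.
Qed.

Lemma rel3_opp q q' : rel3 q q' ->
  rel3 (fun i j k => - q i j k) (fun a b c => - q' a b c).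
Proof.
move=> h i j l; rewrite h rotN; apply: eq_rot => a; rewrite rotN.
by apply: eq_rot => b; rewrite rotN.
Qed.

Lemma rel3_scale c c' q q' : c = c' -> rel3 q q' ->
  rel3 (fun i j k => c * q i j k) (fun a b d => c' * q' a b d).
Proof.
move=> -> h i j l; rewrite h rotZ; apply: eq_rot => a; rewrite rotZ.
by apply: eq_rot => b; rewrite rotZ.
Qed.

Lemma rel3_swap12 q q' : rel3 q q' ->
  rel3 (fun i j k => q j i k) (fun a b c => q' b a c).
Proof. by move=> h i j l; rewrite h rotC. Qed.

Lemma rel3_swap23 q q' : rel3 q q' ->
  rel3 (fun i j k => q i k j) (fun a b c => q' a c b).
Proof. by move=> h i j l; rewrite h; apply: eq_rot => a; rewrite rotC. Qed.

Lemma rel3_outer t t' u u' : rel2 t t' -> rel1 u u' ->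
  rel3 (fun i j k => t i j * u k) (fun a b c => t' a b * u' c).
Proof.
move=> h k i j l; rewrite h k mulrC rotZ; apply: eq_rot => a.
by rewrite rotZ; apply: eq_rot => b; rewrite mulrC rotZ.
Qed.

Lemma rel3_sym q q' : rel3 q q' -> rel3 (sym3 q) (sym3 q').
Proof.
have sym3E r : sym3 r = fun i j k => 6^-1 *
    (r i j k + r i k j + r j i k + r j k i + r k i j + r k j i).
  by apply/funext => i; apply/funext => j; apply/funext => k; rewrite mulrC.
move=> h; have h2 := rel3_swap12 h; have h3 := rel3_swap23 h.
have h4 := rel3_swap23 h2; have h5 := rel3_swap12 h3.
have h6 := rel3_swap12 h4.
rewrite !sym3E; apply: rel3_scale => //.
exact: (rel3_add (rel3_add (rel3_add (rel3_add (rel3_add h h3) h2) h5) h4) h6).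
Qed.

Lemma dot_rel u u' v v' : rel1 u u' -> rel1 v v' ->
  \sum_i u i * v i = \sum_a u' a * v' a.
Proof. by move=> h k; under eq_bigr do rewrite h k; exact: rot_dot. Qed.

Lemma rel1_mul21 t t' u u' : rel2 t t' -> rel1 u u' ->
  rel1 (fun i => \sum_j t i j * u j) (fun a => \sum_b t' a b * u' b).
Proof.
move=> h k i; rewrite (dot_rel (rel2_row i h) k) -rot_sum.
by apply: eq_bigr => b _; rewrite mulrC rotZ; apply: eq_rot => a; rewrite mulrC.
Qed.

Lemma rel2_mul22 t t' s s' : rel2 t t' -> rel2 s s' ->
  rel2 (fun i k => \sum_j t i j * s j k) (fun a c => \sum_b t' a b * s' b c).
Proof.
move=> h k i l; have k2 := rel2_row l (rel2_tr k).
rewrite (rel1_mul21 h k2); apply: eq_rot => a; rewrite -rot_sum.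
by apply: eq_bigr => b _; rewrite rotZ.
Qed.

Lemma trace_rel t t' : rel2 t t' -> \sum_i t i i = \sum_a t' a a.
Proof.
move=> h; have h2 := rel2_mul22 h rel2_kron.
transitivity (\sum_i \sum_a O a i * rotate (t' a) i).
  by apply: eq_bigr => i _; rewrite h.
rewrite exchange_big; apply: eq_bigr => a _.
have /(@rel1_inv _ _)/(_ a) -> : rel1 (rotate (t' a)) (t' a) by [].
by [].
Qed.

Lemma dot2_rel t t' s s' : rel2 t t' -> rel2 s s' ->
  \sum_i \sum_j t i j * s i j = \sum_a \sum_b t' a b * s' a b.
Proof. by move=> h k; apply: (trace_rel (rel2_mul22 h (rel2_tr k))). Qed.

Lemma rel3_slice q q' i : rel3 q q' ->
  rel2 (q i) (fun b c => rotate (fun a => q' a b c) i).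
Proof. by move=> h j k; rewrite h rotC; apply: eq_rot => b; rewrite rotC. Qed.

Lemma rel2_mul31 q q' u u' : rel3 q q' -> rel1 u u' ->
  rel2 (fun i j => \sum_k q i j k * u k) (fun a b => \sum_c q' a b c * u' c).
Proof.
move=> h k i j; rewrite (rel1_mul21 (rel3_slice i h) k) rotC.
apply: eq_rot => b; rewrite -rot_sum; apply: eq_bigr => c _.
by rewrite mulrC rotZ; apply: eq_rot => a; rewrite mulrC.
Qed.

Lemma rel1_trace3 q q' : rel3 q q' ->
  rel1 (fun k => \sum_i q k i i) (fun c => \sum_a q' c a a).
Proof. by move=> h k; rewrite (trace_rel (rel3_slice k h)) rot_sum. Qed.

Lemma rel1_mul32 q q' t t' : rel3 q q' -> rel2 t t' ->
  rel1 (fun k => \sum_i \sum_j q k i j * t i j)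
       (fun c => \sum_a \sum_b q' c a b * t' a b).
Proof.
move=> h k l; rewrite (dot2_rel (rel3_slice l h) k) -rot_sum.
apply: eq_bigr => a _; rewrite -rot_sum; apply: eq_bigr => b _.
by rewrite mulrC rotZ; apply: eq_rot => c; rewrite mulrC.
Qed.

Lemma dot3_rel q q' r r' : rel3 q q' -> rel3 r r' ->
  \sum_i \sum_j \sum_k q i j k * r i j k
  = \sum_a \sum_b \sum_c q' a b c * r' a b c.
Proof.
move=> h k.
transitivity (\sum_i \sum_b \sum_c rotate (fun a => q' a b c) i * rotate
  (fun a => r' a b c) i).
  by apply: eq_bigr => i _; apply: dot2_rel; apply: rel3_slice.
rewrite exchange_big [RHS]exchange_big; apply: eq_bigr => b _.
rewrite exchange_big [RHS]exchange_big; apply: eq_bigr => c _.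
exact: rot_dot.
Qed.

End rotation.

(** * Invariants of a third-order jet *)

Section jets.
Context {R : realType}.

(** The values at one point of the first, second and third derivatives of a
    function.  The definitions below are polynomials in these values: jJ, jZ,
    jX, jphi, ... are the tensors of the same name, and jdJ, jdZ, jdX, jdphi,
    ... are their derivatives, with the index of differentiation first. *)
Record jet := Jet {
  jet1 : 'I_3 -> R;
  jet2 : 'I_3 -> 'I_3 -> R;
  jet3 : 'I_3 -> 'I_3 -> 'I_3 -> R }.

Definition symmetric_jet (q : jet) := [/\ forall i j, jet2 q i j = jet2 q j i,
  forall i j k, jet3 q i j k = jet3 q j i k &
  forall i j k, jet3 q i j k = jet3 q i k j].

Section invariants.
Variable q : jet.
Let p := jet1 q.
Let H := jet2 q.
Let C := jet3 q.
Implicit Types i j k : 'I_3.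

Definition jJ := \sum_i p i * p i.
Definition jlap := \sum_i H i i.
Definition jHp i := \sum_j H i j * p j.
Definition jHpp := \sum_i jHp i * p i.
Definition jZ := jHpp + jJ * jlap.
Definition jHH := \sum_i \sum_j H i j * H i j.
Definition jX := 2 * (\sum_i jHp i * jHp i) - jJ * jHH + jJ * (jlap * jlap).

Definition jdJ k := 2 * jHp k.
Definition jdlap k := \sum_i C k i i.
Definition jdHp k i := \sum_j C k i j * p j + \sum_j H k j * H j i.
Definition jdHpp k := \sum_i jdHp k i * p i + \sum_i H k i * jHp i.
Definition jdZ k := jdHpp k + (jlap * jdJ k + jJ * jdlap k).
Definition jdX k := 4 * (\sum_i jdHp k i * jHp i)
  - (jHH * jdJ k + 2 * jJ * \sum_i \sum_j C k i j * H i j)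
  + (jlap * jlap * jdJ k + 2 * jJ * jlap * jdlap k).

Definition jsigma i := jJ * jdZ i + - (2 * jZ * jdJ i).
Definition jphi i j := jJ * H i j + - (p i * jHp j + p j * jHp i)
  + (2 / 3 * jHpp - 1 / 3 * (jJ * jlap)) * kron i j.
Definition jdphi k i j :=
  H i j * jdJ k + jJ * C k i j
  + - ((jdHp k j * p i + H k i * jHp j) + (jdHp k i * p j + H k j * jHp i))
  + kron i j * (2 / 3 * jdHpp k + - (1 / 3 * (jlap * jdJ k + jJ * jdlap k))).
Definition jdiv j := \sum_i jdphi i i j.
Definition jphidJ i := \sum_j jphi i j * jdJ j.
Definition jrho i j k :=
  jJ * sym3 jdphi i j k + - (3 * sym3 (fun a b c => jphi a b * jdJ c) i j k)
  + - (2 / 5 * jJ * sym3 (fun a b c => kron a b * jdiv c) i j k)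
  + 6 / 5 * sym3 (fun a b c => kron a b * jphidJ c) i j k.
Definition jlambda j := 2 * jJ * jdiv j + - jphidJ j.
Definition jA := \sum_i jsigma i * jsigma i.
Definition jT := \sum_i (\sum_j jphi i j * jsigma j) * jsigma i.
Definition jF := \sum_i \sum_j \sum_k jrho i j k * (jphi i j * jlambda k).
Definition jG := \sum_i (\sum_j jphi i j * jlambda j) * jlambda i.
Definition jK := \sum_i jsigma i * jlambda i.
Definition jN := \sum_k (\sum_i \sum_j jrho k i j * jphi i j) * jsigma k.
Definition jE := 25 / 14 * jN + 3 / 5 * jG + 3 / 4 * jF
     + 1 / 21 * jT - 17 / 21 * (jZ * jK)
     - 7 / 9 * (jZ * jA).

Definition jQ i j := \sum_k C i j k * p k + - (2 * \sum_k H i k * H k j).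
Definition jB k j :=
  jJ * (\sum_i H k i * jQ i j) + - (jHp k * \sum_i jQ j i * p i).
Definition jV (eps : 'I_3 -> 'I_3 -> 'I_3 -> R) :=
  4 * jJ * \sum_j \sum_k \sum_l eps j k l * (jB k j * p l).

(** Values w and derivatives dw k i of a covector field along with the jet of
    f: the equations p.w = 0, w.w = J and jL w = 0, and their derivatives.  In
    jLw the term in which jL contains p.w is left out, and jdnorm is half a
    derivative. *)
Section field.
Variables (w : 'I_3 -> R) (dw : 'I_3 -> 'I_3 -> R).
Definition jperp := \sum_i p i * w i.
Definition jdperp k := \sum_i H k i * w i + \sum_i dw k i * p i.
Definition jnorm := \sum_i w i * w i - jJ.
Definition jdnorm k := \sum_i dw k i * w i + - jHp k.
Definition jHw i := \sum_j H i j * w j.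
Definition jHpw := \sum_i jHp i * w i.
Definition jLw i := jJ * jHw i + - (jHpw * p i) + jHpp * w i.
Definition jdLw k i := jdJ k * jHw i
  + jJ * (\sum_j C k i j * w j + \sum_j dw k j * H j i)
  + - ((\sum_j jdHp k j * w j + \sum_j dw k j * jHp j) * p i + jHpw * H k i)
  + (jdHpp k * w i + jHpp * dw k i).
End field.
End invariants.

(** What is built by tensor operations from related tensors is related, so
    each proof below follows the shape of the definition it is about. *)
Section rotation.
Variable O : 'M[R]_3.
Hypothesis Oorth : O *m O^T = 1%:M.
Notation rel1 := (rel1 O). Notation rel2 := (rel2 O). Notation rel3 := (rel3 O).
Variables (q q' : jet).
Hypotheses (hp : rel1 (jet1 q) (jet1 q')) (hH : rel2 (jet2 q) (jet2 q'))
  (hC : rel3 (jet3 q) (jet3 q')).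

Lemma jJ_rel : jJ q = jJ q'. Proof. exact: (dot_rel Oorth hp hp). Qed.
Lemma jlap_rel : jlap q = jlap q'. Proof. exact: (trace_rel Oorth hH). Qed.
Lemma jHp_rel : rel1 (jHp q) (jHp q'). Proof. exact:
  (rel1_mul21 Oorth hH hp). Qed.
Lemma jHpp_rel : jHpp q = jHpp q'.
Proof. exact: (dot_rel Oorth jHp_rel hp). Qed.
Lemma jZ_rel : jZ q = jZ q'.
Proof. by rewrite /jZ jHpp_rel jJ_rel jlap_rel. Qed.
Lemma jHH_rel : jHH q = jHH q'. Proof. exact: (dot2_rel Oorth hH hH). Qed.

Lemma jdJ_rel : rel1 (jdJ q) (jdJ q').
Proof. exact: (rel1_scale (erefl (2 : R)) jHp_rel). Qed.
Lemma jdlap_rel : rel1 (jdlap q) (jdlap q').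
Proof. exact: (rel1_trace3 Oorth hC). Qed.
Lemma jdHp_rel : rel2 (jdHp q) (jdHp q').
Proof. by apply: rel2_add; [exact: (rel2_mul31 Oorth hC hp)|exact:
  (rel2_mul22 Oorth hH hH)]. Qed.
Lemma jdHpp_rel : rel1 (jdHpp q) (jdHpp q').
Proof.
apply: rel1_add; first exact: (rel1_mul21 Oorth jdHp_rel hp).
exact: (rel1_mul21 Oorth hH jHp_rel).
Qed.
Let dJlap_rel : rel1 (fun k => jlap q * jdJ q k + jJ q * jdlap q k)
  (fun k => jlap q' * jdJ q' k + jJ q' * jdlap q' k).
Proof.
exact: (rel1_add (rel1_scale jlap_rel jdJ_rel) (rel1_scale jJ_rel jdlap_rel)).
Qed.
Lemma jdZ_rel : rel1 (jdZ q) (jdZ q').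
Proof. exact: (rel1_add jdHpp_rel dJlap_rel). Qed.
Lemma jdX_rel : rel1 (jdX q) (jdX q').
Proof.
apply: rel1_add; last first.
  apply: (rel1_add (rel1_scale _ jdJ_rel) (rel1_scale _ jdlap_rel)).
    by rewrite jlap_rel.
  by rewrite jJ_rel jlap_rel.
apply: rel1_add.
  by apply: rel1_scale => //; exact: (rel1_mul21 Oorth jdHp_rel jHp_rel).
apply: rel1_opp; apply: (rel1_add (rel1_scale jHH_rel jdJ_rel)).
apply: (rel1_scale _ (rel1_mul32 Oorth hC hH)); by rewrite jJ_rel.
Qed.

Lemma jsigma_rel : rel1 (jsigma q) (jsigma q').
Proof.
apply: (rel1_add (rel1_scale jJ_rel jdZ_rel)); apply: rel1_opp.
by apply: (rel1_scale _ jdJ_rel); rewrite jZ_rel.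
Qed.
Lemma jphi_rel : rel2 (jphi q) (jphi q').
Proof.
apply: (rel2_add (rel2_add (rel2_scale jJ_rel hH) (rel2_opp _))).
  apply: (rel2_add (rel2_outer hp jHp_rel)).
  exact: (rel2_tr (rel2_outer hp jHp_rel)).
by apply: (rel2_scale _ (rel2_kron Oorth)); rewrite jHpp_rel jJ_rel jlap_rel.
Qed.
Let rot3 (r r' : 'I_3 -> 'I_3 -> 'I_3 -> R) : rel3 r r' ->
  rel3 (fun k i j => r i j k) (fun k i j => r' i j k).
Proof. by move=> h; exact: (rel3_swap12 (rel3_swap23 h)). Qed.
Lemma jdphi_rel : rel3 (jdphi q) (jdphi q').
Proof.
have h1 : rel3 (fun k i j => jdHp q k j * jet1 q i + jet2 q k i * jHp q j)
    (fun k i j => jdHp q' k j * jet1 q' i + jet2 q' k i * jHp q' j).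
  apply: (rel3_add _ (rel3_outer hH jHp_rel)).
  exact: (rel3_swap23 (rel3_outer jdHp_rel hp)).
have h2 := rel3_swap23 h1.
apply: rel3_add; last first.
  by apply: (rot3 (rel3_outer (rel2_kron Oorth) (rel1_add
    (rel1_scale _ jdHpp_rel)
    (rel1_opp (rel1_scale _ dJlap_rel))))).
apply: rel3_add; last exact: (rel3_opp (rel3_add h1 h2)).
exact: (rel3_add (rot3 (rel3_outer hH jdJ_rel)) (rel3_scale jJ_rel hC)).
Qed.
Lemma jdiv_rel : rel1 (jdiv q) (jdiv q').
Proof. exact: (rel1_trace3 Oorth (rot3 jdphi_rel)). Qed.
Lemma jphidJ_rel : rel1 (jphidJ q) (jphidJ q').
Proof. exact: (rel1_mul21 Oorth jphi_rel jdJ_rel). Qed.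
Lemma jrho_rel : rel3 (jrho q) (jrho q').
Proof.
have k2 := rel2_kron Oorth.
apply: rel3_add; last first.
  by apply: rel3_scale => //; exact: (rel3_sym (rel3_outer k2 jphidJ_rel)).
apply: rel3_add; last first.
  apply: rel3_opp; apply: rel3_scale; first by rewrite jJ_rel.
  exact: (rel3_sym (rel3_outer k2 jdiv_rel)).
apply: (rel3_add (rel3_scale jJ_rel (rel3_sym jdphi_rel)) _).
apply: rel3_opp; apply: rel3_scale => //.
exact: (rel3_sym (rel3_outer jphi_rel jdJ_rel)).
Qed.
Lemma jlambda_rel : rel1 (jlambda q) (jlambda q').
Proof.
apply: rel1_add; last exact: (rel1_opp jphidJ_rel).
by apply: (rel1_scale _ jdiv_rel); rewrite jJ_rel.
Qed.
Lemma jE_rel : jE q = jE q'.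
Proof.
rewrite /jE /jN /jG /jF /jT /jK /jA.
rewrite (dot_rel Oorth (rel1_mul32 Oorth jrho_rel jphi_rel) jsigma_rel).
rewrite (dot_rel Oorth (rel1_mul21 Oorth jphi_rel jlambda_rel) jlambda_rel).
rewrite (dot_rel Oorth (rel1_mul21 Oorth jphi_rel jsigma_rel) jsigma_rel).
rewrite (dot_rel Oorth jsigma_rel jlambda_rel).
rewrite (dot_rel Oorth jsigma_rel jsigma_rel) jZ_rel.
by rewrite (dot3_rel Oorth jrho_rel (rel3_outer jphi_rel jlambda_rel)).
Qed.

Lemma jQ_rel : rel2 (jQ q) (jQ q').
Proof.
apply: (rel2_add (rel2_mul31 Oorth hC hp)); apply: rel2_opp.
by apply: (rel2_scale _ (rel2_mul22 Oorth hH hH)).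
Qed.
Lemma jB_rel : rel2 (jB q) (jB q').
Proof.
apply: (rel2_add (rel2_scale jJ_rel (rel2_mul22 Oorth hH jQ_rel))).
exact: (rel2_opp (rel2_outer jHp_rel (rel1_mul21 Oorth jQ_rel hp))).
Qed.
Lemma jV_rel e e' : rel3 e e' -> jV q e = jV q' e'.
Proof.
move=> he; rewrite /jV jJ_rel; congr (_ * _).
exact: (dot3_rel Oorth he (rel3_outer (rel2_tr jB_rel) hp)).
Qed.

Section field.
Variables (w w' : 'I_3 -> R) (dw dw' : 'I_3 -> 'I_3 -> R).
Hypotheses (hw : rel1 w w') (hdw : rel2 dw dw').
Lemma jdperp_rel : rel1 (jdperp q w dw) (jdperp q' w' dw').
Proof.
exact: (rel1_add (rel1_mul21 Oorth hH hw) (rel1_mul21 Oorth hdw hp)).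
Qed.
Lemma jdnorm_rel : rel1 (jdnorm q w dw) (jdnorm q' w' dw').
Proof. exact: (rel1_add (rel1_mul21 Oorth hdw hw) (rel1_opp jHp_rel)). Qed.
Lemma jHw_rel : rel1 (jHw q w) (jHw q' w').
Proof. exact: (rel1_mul21 Oorth hH hw). Qed.
Lemma jHpw_rel : jHpw q w = jHpw q' w'.
Proof. exact: (dot_rel Oorth jHp_rel hw). Qed.
Lemma jLw_rel : rel1 (jLw q w) (jLw q' w').
Proof.
apply: (rel1_add _ (rel1_scale jHpp_rel hw)).
apply: (rel1_add (rel1_scale jJ_rel jHw_rel) (rel1_opp _)).
exact: (rel1_scale jHpw_rel hp).
Qed.
Lemma jdLw_rel : rel2 (jdLw q w dw) (jdLw q' w' dw').
Proof.
apply: rel2_add; last first.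
  exact: (rel2_add (rel2_outer jdHpp_rel hw) (rel2_scale jHpp_rel hdw)).
apply: rel2_add.
  apply: (rel2_add (rel2_outer jdJ_rel jHw_rel)); apply: (rel2_scale jJ_rel _).
  exact: (rel2_add (rel2_mul31 Oorth hC hw) (rel2_mul22 Oorth hdw hH)).
apply: rel2_opp; apply: (rel2_add _ (rel2_scale jHpw_rel hH)).
apply: (rel2_outer _ hp).
exact: (rel1_add (rel1_mul21 Oorth jdHp_rel hw)
  (rel1_mul21 Oorth hdw jHp_rel)).
Qed.
End field.
End rotation.
End jets.

(** * Computing with three indices *)

Definition tri {T : Type} (x y z : T) (i : 'I_3) : T :=
  match val i with 0%N => x | 1%N => y | _ => z end.

Definition o0 : 'I_3 := Ordinal (isT : 0 < 3)%N.
Definition o1 : 'I_3 := Ordinal (isT : 1 < 3)%N.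
Definition o2 : 'I_3 := Ordinal (isT : 2 < 3)%N.

Lemma ord3_ind (P : 'I_3 -> Prop) : P o0 -> P o1 -> P o2 -> forall i, P i.
Proof.
move=> h0 h1 h2 [[|[|[|//]]] /= h].
- by rewrite (_ : Ordinal h = o0) //; exact: val_inj.
- by rewrite (_ : Ordinal h = o1) //; exact: val_inj.
- by rewrite (_ : Ordinal h = o2) //; exact: val_inj.
Qed.

Lemma sum3 {R : realType} (F : 'I_3 -> R) : \sum_i F i = F o0 + F o1 + F o2.
Proof.
rewrite !big_ord_recl big_ord0 addr0 addrA.
by congr (F _ + F _ + F _); exact: val_inj.
Qed.

Lemma kronE {R : realType} :
  ((kron o0 o0 = 1 :> R) * (kron o0 o1 = 0 :> R) * (kron o0 o2 = 0 :> R)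
  * (kron o1 o0 = 0 :> R) * (kron o1 o1 = 1 :> R) * (kron o1 o2 = 0 :> R)
  * (kron o2 o0 = 0 :> R) * (kron o2 o1 = 0 :> R)
  * (kron o2 o2 = 1 :> R))%type.
Proof. by []. Qed.

Section alternating.
Context {R : realType}.
Variable e : 'I_3 -> 'I_3 -> 'I_3 -> R.
Hypothesis e12 : forall i j k, e j i k = - e i j k.
Hypothesis e23 : forall i j k, e i k j = - e i j k.

Definition levi_civita : 'I_3 -> 'I_3 -> 'I_3 -> R :=
  tri (tri (tri 0 0 0) (tri 0 0 1) (tri 0 (- 1) 0))
      (tri (tri 0 0 (- 1)) (tri 0 0 0) (tri 1 0 0))
      (tri (tri 0 1 0) (tri (- 1) 0 0) (tri 0 0 0)).

(** An alternating 3-tensor on R^3 has a single free component, which is all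
    that V needs to know about the volume form. *)
Lemma alternating3E i j k : e i j k = e o0 o1 o2 * levi_civita i j k.
Proof.
have opp0 (x : R) : x = - x -> x = 0.
  by move=> h; apply/eqP; rewrite -[_ == 0](mulrn_eq0 _ 2) mulr2n {1}h addNr.
have d12 a b : e a a b = 0 by exact: opp0.
have d23 a b : e a b b = 0 by exact: opp0.
have d13 a b : e a b a = 0 by rewrite e12 d23 oppr0.
have e021 : e o0 o2 o1 = - e o0 o1 o2 by [].
have e120 : e o1 o2 o0 = e o0 o1 o2 by rewrite e23 e12 opprK.
rewrite /levi_civita /tri; move: i j k; do 3 elim/ord3_ind;
  rewrite /= ?d12 ?d23 ?d13 ?mulr0 ?mulr1 ?mulrN1 //.
by rewrite e12 e021 opprK.
by rewrite e12 e120.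
Qed.

Lemma alternating3_norm :
  \sum_i \sum_j \sum_k e i j k * e i j k = 6 * e o0 o1 o2 ^+ 2.
Proof.
under eq_bigr do under eq_bigr do under eq_bigr do rewrite alternating3E.
by rewrite !sum3 /levi_civita /tri /=; ring.
Qed.
End alternating.

(** * Values in the adapted frame *)

Section frame.
Context {R : realType}.
Variables (s al b c z c111 c222 c223 c123 c133 c233 c333 : R).

Let c122 := - c111 - 2 * c * c.
Let c112 := - c222.
Let c113 := - c223 + 2 * al * c - 2 * c * z.
(** The jet of f in the frame e1 = p/s, e2 = w/s, e3, for w in the kernel of
    jL and |p| = |w| = s.  Being in that kernel makes the Hessian diagonal on
    the plane of e2 and e3 with first entry -al, and the vanishing of jdX
    gives the values of c122, c112 and c113.  All derivatives are divided by
    s, which keeps every value below polynomial. *)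
Definition frame_jet : jet :=
  Jet (tri s 0 0)
   (fun i j => s * tri (tri al b c) (tri b (- al) 0) (tri c 0 (z - al)) i j)
   (fun i j k => s * tri
     (tri (tri c111 c112 c113) (tri c112 c122 c123) (tri c113 c123 c133))
     (tri (tri c112 c122 c123) (tri c122 c222 c223) (tri c123 c223 c233))
     (tri (tri c113 c123 c133) (tri c123 c223 c233)
       (tri c133 c233 c333)) i j k).
Let q := frame_jet.

Ltac go := rewrite ?sum3 /= /tri /= ?kronE; ring.
Ltac go1 := elim/ord3_ind; go.

Let JE : jJ q = s ^+ 2. Proof. rewrite /jJ; go. Qed.
Let lapE : jlap q = s * (z - al). Proof. rewrite /jlap; go. Qed.
Let HpE i : jHp q i = s ^+ 2 * tri al b c i.
Proof. move: i; rewrite /jHp; go1. Qed.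
Let HppE : jHpp q = s ^+ 3 * al. Proof. rewrite /jHpp !sum3 !HpE; go. Qed.
Lemma frame_Z : jZ q = s ^+ 3 * z.
Proof. rewrite /jZ HppE JE lapE; go. Qed.
Let dJE i : jdJ q i = s ^+ 2 * tri (2 * al) (2 * b) (2 * c) i.
Proof. move: i; rewrite /jdJ; elim/ord3_ind; rewrite HpE; go. Qed.
Let dlapE i : jdlap q i = s * tri (c111 + c122 + c133) (c112 + c222 + c233)
  (c113 + c223 + c333) i.
Proof. move: i; rewrite /jdlap; go1. Qed.
Let dHpE k i : jdHp q k i = s ^+ 2 * tri
  (tri (c111 + al ^+ 2 + b ^+ 2 + c ^+ 2) c112 (c113 + c * z))
  (tri c112 (c122 + al ^+ 2 + b ^+ 2) (c123 + b * c))
  (tri (c113 + c * z) (c123 + b * c) (c133 + c ^+ 2 + (z - al) ^+ 2)) k i.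
Proof.
by move: k i; rewrite /jdHp; elim/ord3_ind; elim/ord3_ind;
  rewrite ?sum3 /= /tri /=; ring.
Qed.
Let dHppE k : jdHpp q k = s ^+ 3 * tri
  (c111 + 2 * al ^+ 2 + 2 * b ^+ 2 + 2 * c ^+ 2) c112 (c113 + 2 * c * z) k.
Proof.
by move: k; rewrite /jdHpp; elim/ord3_ind; rewrite !sum3 !dHpE !HpE /= /tri /=;
  ring.
Qed.
Let phiE i j : jphi q i j = s ^+ 3 * z
  * tri (tri (- 1 / 3) 0 0) (tri 0 (- 1 / 3) 0) (tri 0 0 (2 / 3)) i j.
Proof.
by move: i j; rewrite /jphi HppE lapE JE; elim/ord3_ind; elim/ord3_ind;
  rewrite !HpE kronE /= /tri /=; field.
Qed.
Let dZE k : jdZ q k = s ^+ 3 * (tri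
  (c111 + 2 * al ^+ 2 + 2 * b ^+ 2 + 2 * c ^+ 2) c112 (c113 + 2 * c * z) k
  + 2 * (z - al) * tri al b c k
  + tri (c111 + c122 + c133) (c112 + c222 + c233) (c113 + c223 + c333) k).
Proof.
by move: k; rewrite /jdZ JE lapE; elim/ord3_ind;
  rewrite dHppE dJE dlapE /= /tri /=; ring.
Qed.
Let sigmaE i : jsigma q i = s ^+ 5 * tri
  (2 * b ^+ 2 + c111 + c133 - 2 * al * z)
  (- c222 + c233 - 2 * al * b - 2 * b * z)
  (- c223 + c333 + 2 * al * c - 4 * c * z) i.
Proof.
move: i; rewrite /jsigma JE frame_Z.
by elim/ord3_ind; rewrite dZE dJE /= /tri /= /c122 /c112 /c113; ring.
Qed.
Let divE j : jdiv q j = s ^+ 3 * tri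
  (- 2 / 3 * b ^+ 2 - 1 / 3 * c111 - 1 / 3 * c133 - z ^+ 2 + 1 / 3 * al * z)
  (1 / 3 * c222 + 2 / 3 * c233 + 5 / 3 * al * b - 5 / 3 * b * z)
  (1 / 3 * c223 + 2 / 3 * c333 + 7 / 3 * al * c - c * z) j.
Proof.
by move: j; rewrite /jdiv /jdphi lapE JE; elim/ord3_ind;
rewrite !sum3 !dHppE !dHpE !HpE !dJE !dlapE !kronE /= /tri /= /c122 /c112 /c113;
  field.
Qed.
Let phidJE j : jphidJ q j = s ^+ 5 * z
  * tri (- 2 / 3 * al) (- 2 / 3 * b) (4 / 3 * c) j.
Proof.
by move: j; rewrite /jphidJ; elim/ord3_ind; rewrite sum3 !phiE !dJE /= /tri /=;
  field.
Qed.
Let lambdaE j : jlambda q j = s ^+ 5 * tri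
  (- 4 / 3 * b ^+ 2 - 2 / 3 * c111 - 2 / 3 * c133 - 2 * z ^+ 2 + 4 / 3 * al * z)
  (2 / 3 * c222 + 4 / 3 * c233 + 10 / 3 * al * b - 8 / 3 * b * z)
  (2 / 3 * c223 + 4 / 3 * c333 + 14 / 3 * al * c - 10 / 3 * c * z) j.
Proof.
by move: j; rewrite /jlambda JE; elim/ord3_ind; rewrite divE phidJE /= /tri /=;
  field.
Qed.
(** Only these components of rho are needed, because phi is diagonal here. *)
Let rhoE k i : jrho q k i i = s ^+ 5 * tri
  (tri (- 2 / 5 * b ^+ 2 - 1 / 5 * c111 - 1 / 5 * c133 + 2 / 5 * z ^+ 2 + 2 / 5
    * al * z)
       (- 2 / 15 * b ^+ 2 - 1 / 15 * c111 - 1 / 15 * c133 + 2 / 15 * z ^+ 2 + 2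
         / 15 * al * z)
       (8 / 15 * b ^+ 2 + 4 / 15 * c111 + 4 / 15 * c133 - 8 / 15 * z ^+ 2 - 8 /
         15 * al * z))
  (tri (1 / 15 * c222 - 1 / 5 * c233 + 2 / 5 * b * z)
       (1 / 5 * c222 - 3 / 5 * c233 + 6 / 5 * b * z)
       (- 4 / 15 * c222 + 4 / 5 * c233 - 8 / 5 * b * z))
  (tri (1 / 15 * c223 - 1 / 5 * c333 - 8 / 15 * al * c + 2 / 3 * c * z)
       (11 / 15 * c223 - 1 / 5 * c333 + 2 / 15 * al * c + 4 / 3 * c * z)
       (- 4 / 5 * c223 + 2 / 5 * c333 + 2 / 5 * al * c - 2 * c * z)) k i.
Proof.
by move: k i; rewrite /jrho /sym3 /jdphi lapE JE; elim/ord3_ind; elim/ord3_ind;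
rewrite !phiE !divE !phidJE !dHppE !dHpE !HpE !dJE !dlapE !kronE /= /tri /=
  /c122 /c112 /c113; field.
Qed.
Let rho_sym i j k : jrho q i j k = jrho q k i j.
Proof. by rewrite /jrho /sym3; ring. Qed.
(** With the coefficients 25/14, 3/5, ... every third derivative but c223
    cancels and a perfect square is left. *)
Lemma frame_E : jE q = s ^+ 13 * z * (c223 + c * (al + z)) ^+ 2.
Proof.
have TE : jT q = s ^+ 3 * z * (- 1 / 3 * (jsigma q o0 ^+ 2 + jsigma q o1 ^+ 2)
  + 2 / 3 * jsigma q o2 ^+ 2).
  by rewrite /jT !sum3 !phiE /= /tri /=; ring.
have GE : jG q = s ^+ 3 * z * (- 1 / 3 * (jlambda q o0 ^+ 2 + jlambda q o1 ^+ 2)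
  + 2 / 3 * jlambda q o2 ^+ 2).
  by rewrite /jG !sum3 !phiE /= /tri /=; ring.
have tr_rho u : \sum_k (\sum_i \sum_j jrho q k i j * jphi q i j) * u k
   = s ^+ 3 * z * \sum_k (- 1 / 3 * (jrho q k o0 o0 + jrho q k o1 o1)
  + 2 / 3 * jrho q k o2 o2) * u k.
  by rewrite !sum3 !phiE /= /tri /=; ring.
have FE : jF q = \sum_k (\sum_i \sum_j jrho q k i j * jphi q i j) * jlambda q k.
  transitivity (\sum_i \sum_k \sum_j
      jrho q i j k * (jphi q i j * jlambda q k)).
    by apply: eq_bigr => i _; rewrite exchange_big.
  rewrite exchange_big.
  apply: eq_bigr => k _; rewrite mulr_suml; apply: eq_bigr => i _.
  rewrite mulr_suml; apply: eq_bigr => j _.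
  by rewrite rho_sym mulrA.
rewrite /jE TE GE FE /jN /jK /jA !tr_rho frame_Z !sum3 !rhoE !sigmaE !lambdaE.
by rewrite /= /tri /=; field.
Qed.
(** V measures the commutator of H with Q on the plane orthogonal to p, where
    H is diagonal with eigenvalues -al and z - al; so only Q23 is left. *)
Lemma frame_V (e : 'I_3 -> 'I_3 -> 'I_3 -> R) :
  (forall i j k, e j i k = - e i j k) -> (forall i j k, e i k j = - e i j k) ->
  jV q e = 4 * s ^+ 8 * z * (c123 - 2 * b * c) * e o0 o1 o2.
Proof.
move=> e12 e23; have := alternating3E e12 e23.
move: (e o0 o1 o2) => e0 eE.
have -> : jV q e = 4 * jJ q * (e0 * (jB q o2 o1 - jB q o1 o2) * s).
  rewrite /jV; move: (jJ q) (jB q) => J0 B.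
  by rewrite !sum3 !eE /levi_civita /= /tri /=; ring.
by rewrite /jB /jQ JE !sum3 !HpE /= /tri /=; ring.
Qed.
End frame.

(** * Closedness at a point *)

Section pointwise.
Context {R : realType}.
Implicit Types (q : jet (R := R)) (w : 'I_3 -> R) (dw : 'I_3 -> 'I_3 -> R).

Definition kernel_field q w dw := [/\ symmetric_jet q,
  forall i, jLw q w i = 0,
  forall k, jdperp q w dw k = 0,
  forall k, jdnorm q w dw k = 0 &
  forall k i, jdLw q w dw k i = 0].

(** Both equations are compared with dw after solving for dw: the first two
    components of the derivative of w come from p.w = 0 and w.w = J, the third
    from jL w = 0, where it is multiplied by z. *)
Lemma closed_iff_in_frame q w dw e (s : R) : s != 0 ->
  jet1 q = tri s 0 0 -> w = tri 0 s 0 ->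
  kernel_field q w dw -> jZ q != 0 -> (forall k, jdX q k = 0) ->
  (forall i j k, e j i k = - e i j k) -> (forall i j k, e i k j = - e i j k) ->
  e o0 o1 o2 != 0 ->
  (forall i j, dw i j = dw j i) <-> jV q e = 0 /\ jE q = 0.
Proof.
move: q => [p H C] s0 /= -> -> [[/= Hs Cs12 Cs23] Lw dperp dnorm dLw] Z0 dX.
move=> e12 e23 e0.
have cancel (x y : R) : y != 0 -> y * x = 0 -> x = 0.
  by move=> y0 /eqP; rewrite mulf_eq0 (negPf y0) => /eqP.
(* These two equations are jL w = 0 in the frame. *)
have H11 : H o1 o1 = - H o0 o0.
  apply/eqP; rewrite -addr_eq0; apply/eqP; apply: (@cancel _ (s ^+ 3)).
    by rewrite expf_neq0.
  rewrite -[RHS](Lw o1) /jLw /jJ /jHw /jHpw /jHpp /jHp !sum3 /= /tri /=; ring.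
have H12 : H o1 o2 = 0.
  apply: (@cancel _ (s ^+ 3)); first by rewrite expf_neq0.
  rewrite Hs -[RHS](Lw o2) /jLw /jJ /jHw /jHpw /jHpp /jHp !sum3 /= /tri /=;
    ring.
pose al := H o0 o0 / s; pose b := H o0 o1 / s; pose c := H o0 o2 / s.
pose z := H o2 o2 / s + al.
have HE : H = (fun i j => s * tri (tri al b c) (tri b (- al) 0) (tri c 0
  (z - al)) i j).
  apply/funext => i; apply/funext => j; move: i j.
  elim/ord3_ind; elim/ord3_ind;
    rewrite ?H11 ?(Hs o2 o1) ?H12 ?(Hs o1 o0) ?(Hs o2 o0) /tri /= /z /al /b /c;
    by field.
pose D i j k := C i j k / s.
pose DT := tri
  (tri (tri (D o0 o0 o0) (D o0 o0 o1) (D o0 o0 o2))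
       (tri (D o0 o0 o1) (D o0 o1 o1) (D o0 o1 o2))
       (tri (D o0 o0 o2) (D o0 o1 o2) (D o0 o2 o2)))
  (tri (tri (D o0 o0 o1) (D o0 o1 o1) (D o0 o1 o2))
       (tri (D o0 o1 o1) (D o1 o1 o1) (D o1 o1 o2))
       (tri (D o0 o1 o2) (D o1 o1 o2) (D o1 o2 o2)))
  (tri (tri (D o0 o0 o2) (D o0 o1 o2) (D o0 o2 o2))
       (tri (D o0 o1 o2) (D o1 o1 o2) (D o1 o2 o2))
       (tri (D o0 o2 o2) (D o1 o2 o2) (D o2 o2 o2))).
have CE : C = (fun i j k => s * DT i j k).
  apply/funext => i; apply/funext => j; apply/funext => k.
  transitivity (s * D i j k); first by rewrite /D; field.
  congr (_ * _).
  have Ds12 a b' d : D a b' d = D b' a d by rewrite /D Cs12.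
  have Ds23 a b' d : D a b' d = D a d b' by rewrite /D Cs23.
  move: i j k; do 3 elim/ord3_ind; rewrite /DT /tri //=;
    first [exact: Ds12 | exact: Ds23 | by rewrite Ds12 Ds23 | by rewrite Ds23
      Ds12
      | by rewrite Ds12 Ds23 Ds12].
have z0 : z != 0.
  apply: contraNneq Z0 => z0;
    rewrite /jZ /jHpp /jHp /jJ /jlap HE !sum3 /= /tri /=.
  by rewrite z0; apply/eqP; ring.
clearbody al b c z D; subst H C.
have zs : 2 * (s ^+ 4 * z) != 0 by rewrite !mulf_neq0 ?expf_neq0 ?pnatr_eq0.
(* The derivative of X in the frame is 2 s^4 z times these relations. *)
have D122 : D o0 o1 o1 = - D o0 o0 o0 - 2 * c * c.
  apply/eqP; rewrite -subr_eq0; apply/eqP; apply: (cancel _ _ zs).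
  rewrite -[RHS](dX o0) /jdX /jHH /jdHp /jHp /jdJ /jJ /jHp /jlap /jdlap !sum3
    /= /DT /tri /=; ring.
have D112 : D o0 o0 o1 = - D o1 o1 o1.
  apply/eqP; rewrite -subr_eq0; apply/eqP; apply: (cancel _ _ zs).
  rewrite -[RHS](dX o1) /jdX /jHH /jdHp /jHp /jdJ /jJ /jHp /jlap /jdlap !sum3
    /= /DT /tri /=; ring.
have D113 : D o0 o0 o2 = - D o1 o1 o2 + 2 * al * c - 2 * c * z.
  apply/eqP; rewrite -subr_eq0; apply/eqP; apply: (cancel _ _ zs).
  rewrite -[RHS](dX o2) /jdX /jHH /jdHp /jHp /jdJ /jJ /jHp /jlap /jdlap !sum3
    /= /DT /tri /=; ring.
have dw0 k : dw k o0 = - (s * tri b (- al) 0 k).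
  apply/eqP; rewrite -subr_eq0; apply/eqP; apply: (cancel _ _ s0).
  by rewrite -[RHS](dperp k) /jdperp !sum3; move: k; elim/ord3_ind;
    rewrite /= /tri /=; ring.
have dw1 k : dw k o1 = s * tri al b c k.
  apply/eqP; rewrite -subr_eq0; apply/eqP; apply: (cancel _ _ s0).
  by rewrite -[RHS](dnorm k) /jdnorm /jHp !sum3; move: k; elim/ord3_ind;
    rewrite /= /tri /=; ring.
have dw2 k : z * dw k o2 = s * tri (2 * b * c - D o0 o1 o2) (-
  (al * c) - D o1 o1 o2)
    (b * (z - al) - D o1 o2 o2) k.
  apply/eqP; rewrite -subr_eq0; apply/eqP; apply: (cancel _ (s ^+ 3)).
    by rewrite expf_neq0.
  rewrite -[RHS](dLw k o2) /jdLw /jHw /jHpw /jdHp /jdHpp /jHpp /jdJ /jJ /jHp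
    !sum3 !dw0 !dw1.
  by move: k; elim/ord3_ind; rewrite /= /DT /tri /=; ring.
pose q' := frame_jet s al b c z (D o0 o0 o0) (D o1 o1 o1) (D o1 o1 o2)
  (D o0 o1 o2) (D o0 o2 o2) (D o1 o2 o2) (D o2 o2 o2).
rewrite [X in jV X](_ : _ = q') ?[X in jE X](_ : _ = q'); last 2 first.
- by rewrite /q' /frame_jet /DT D122 D112 D113.
- by rewrite /q' /frame_jet /DT D122 D112 D113.
rewrite frame_V // frame_E.
split=> [sym|[V0 E0]].
- have e1 : D o0 o1 o2 - 2 * b * c = 0.
    apply: (cancel _ s s0); have := dw2 o0.
    by rewrite sym dw0 /tri /= => h; rewrite -[RHS](subrr (z * - (s * 0))) {2}h;
      ring.
  have e2 : D o1 o1 o2 + c * (al + z) = 0.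
    apply: (cancel _ s s0); have := dw2 o1.
    by rewrite sym dw1 /tri /= => h; rewrite -[RHS](subrr (z * (s * c))) {2}h;
      ring.
  by rewrite e1 e2 expr0n /= !(mulr0, mul0r).
- have e1 : D o0 o1 o2 = 2 * b * c.
    apply/eqP; rewrite -subr_eq0; apply/eqP.
    apply: (cancel _ (4 * s ^+ 8 * z * e o0 o1 o2)).
      by rewrite !mulf_neq0 ?expf_neq0 ?pnatr_eq0.
    by rewrite -[RHS]V0; ring.
  have e2 : D o1 o1 o2 = - (c * (al + z)).
    apply/eqP; rewrite -addr_eq0 -sqrf_eq0; apply/eqP.
    apply: (cancel _ (s ^+ 13 * z)) => //.
    by rewrite mulf_neq0 ?expf_neq0.
  have dw02 : dw o0 o2 = 0.
    by apply: (cancel _ _ z0); rewrite dw2 /tri /= e1; ring.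
  have dw12 : dw o1 o2 = s * c.
    apply/eqP; rewrite -subr_eq0; apply/eqP; apply: (cancel _ _ z0).
    by rewrite mulrBr dw2 /tri /= e2; ring.
  elim/ord3_ind; elim/ord3_ind;
    rewrite ?dw0 ?dw1 ?dw02 ?dw12 // ?dw0 ?dw1 /tri /=;
    ring.
Qed.

(** The third vector of the frame is the cross product, of length s^2. *)
Lemma orthonormal_frame (p w : 'I_3 -> R) (s : R) : s != 0 ->
  \sum_i p i * p i = s ^+ 2 -> \sum_i w i * w i = s ^+ 2 ->
  \sum_i p i * w i = 0 ->
  exists O : 'M[R]_3, [/\ O *m O^T = 1%:M, rel1 O p (tri s 0 0) &
    rel1 O w (tri 0 s 0)].
Proof.
move=> s0; rewrite !sum3 => hp hw hpw.
pose O : 'M[R]_3 := \matrix_(a, i) tri (p i / s) (w i / s)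
  (tri (p o1 * w o2 - p o2 * w o1) (p o2 * w o0 - p o0 * w o2)
       (p o0 * w o1 - p o1 * w o0) i / s ^+ 2) a.
have rowO a b : \sum_i O a i * O b i = kron a b.
  have ss x : x = s ^+ 2 -> x / s ^+ 2 = 1 by move=> ->;
    rewrite divff ?expf_neq0.
  have cr : (p o1 * w o2 - p o2 * w o1) ^+ 2 + (p o2 * w o0 - p o0 * w o2) ^+ 2
     + (p o0 * w o1 - p o1 * w o0) ^+ 2 = s ^+ 4.
    rewrite [RHS](_ : _ = s ^+ 2 * s ^+ 2 - 0 ^+ 2); last by ring.
    by rewrite -{1}hp -hw -hpw; ring.
  move: a b; elim/ord3_ind; elim/ord3_ind;
    rewrite sum3 !mxE /tri /kron /= ?mulr0n ?mulr1n.
  - by rewrite -[RHS](ss _ hp); field.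
  - by rewrite -[RHS](mul0r (s ^- 2)) -hpw; field.
  - by field.
  - by rewrite -[RHS](mul0r (s ^- 2)) -hpw; field.
  - by rewrite -[RHS](ss _ hw); field.
  - by field.
  - by field.
  - by field.
  - rewrite -[RHS](divff (expf_neq0 4 s0)) -{1}cr; field; exact: s0.
exists O; split.
- apply/matrixP => a b; rewrite mxE [RHS]mxE -[RHS]/(kron a b) -rowO.
  by apply: eq_bigr => i _; congr (_ * _); rewrite mxE.
- by move=> i; rewrite /rotate sum3 !mxE /tri /=; field.
- by move=> i; rewrite /rotate sum3 !mxE /tri /=; field.
Qed.

(** The pointwise criterion in arbitrary coordinates: every hypothesis and
    both sides of the equivalence are transported to the frame of p and w. *)
Lemma closed_iff q w dw e : kernel_field q w dw ->
  0 < jJ q -> jZ q != 0 -> (forall k, jdX q k = 0) ->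
  jperp q w = 0 -> jnorm q w = 0 ->
  (forall i j k, e j i k = - e i j k) -> (forall i j k, e i k j = - e i j k) ->
  \sum_i \sum_j \sum_k e i j k * e i j k = 6 ->
  (forall i j, dw i j = dw j i) <-> jV q e = 0 /\ jE q = 0.
Proof.
move=> [[Hs C12 C23] Lw dperp dnorm dLw] J0 Z0 dX perp norm e12 e23 e6.
have s0 : Num.sqrt (jJ q) != 0 by rewrite sqrtr_eq0 -ltNge.
have s2 : Num.sqrt (jJ q) ^+ 2 = jJ q by rewrite sqr_sqrtr // ltW.
have wnorm : \sum_i w i * w i = Num.sqrt (jJ q) ^+ 2.
  by apply/eqP; rewrite s2 -subr_eq0; apply/eqP.
have [Q [QQ hp hw]] := orthonormal_frame s0 (esym s2) wnorm perp.
have [H' hH] := rel2_exists QQ (jet2 q).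
have [C' hC] := rel3_exists QQ (jet3 q).
have [dw' hdw] := rel2_exists QQ dw.
have [e' he] := rel3_exists QQ e.
have e'12 : forall a b d, e' b a d = - e' a b d.
  apply: (rel3_inj QQ (rel3_swap12 he)) => i j k; rewrite e12; exact:
    (rel3_opp he).
have e'23 : forall a b d, e' a d b = - e' a b d.
  apply: (rel3_inj QQ (rel3_swap23 he)) => i j k; rewrite e23; exact:
    (rel3_opp he).
pose q' := Jet (tri (Num.sqrt (jJ q)) 0 0) H' C'.
have sym2P t t' : rel2 Q t t' -> (forall i j, t i j = t j i) <->
    (forall a b, t' a b = t' b a).
  move=> ht; split=> ts; last by move=> i j; rewrite !ht rotC; apply: eq_rot =>
    a;
    apply: eq_rot => b; exact: ts.
  apply: (rel2_inj QQ ht) => i j; rewrite ts; exact: (rel2_tr ht).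
rewrite (sym2P _ _ hdw) (jV_rel (q' := q') QQ hp hH hC he) (jE_rel (q' :=
  q') QQ hp hH hC).
apply: (@closed_iff_in_frame q' (tri 0 (Num.sqrt (jJ q)) 0) dw' e' _ s0
  erefl erefl).
- split.
  + split=> /=; first exact: (proj1 (sym2P _ _ hH)).
      apply: (rel3_inj QQ hC) => i j k; rewrite C12; exact: (rel3_swap12 hC).
    apply: (rel3_inj QQ hC) => i j k; rewrite C23; exact: (rel3_swap23 hC).
  + exact: (rel1_eq0 QQ (jLw_rel (q' := q') QQ hp hH hw) Lw).
  + exact: (rel1_eq0 QQ (jdperp_rel (q' := q') QQ hp hH hw hdw) dperp).
  + exact: (rel1_eq0 QQ (jdnorm_rel (q' := q') QQ hp hH hw hdw) dnorm).
  + exact: (rel2_eq0 QQ (jdLw_rel (q' := q') QQ hp hH hC hw hdw) dLw).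
- by rewrite -(jZ_rel (q := q) QQ).
- exact: (rel1_eq0 QQ (jdX_rel (q' := q') QQ hp hH hC) dX).
- exact: e'12.
- exact: e'23.
- apply: contra_eq_neq (etrans (esym (dot3_rel QQ he he)) e6) => e'0.
  by rewrite (alternating3_norm e'12 e'23) e'0 expr0n mulr0 eq_sym pnatr_eq0.
Qed.
End pointwise.

(** * The null line *)

Section kernel.
Context {R : realType}.
Variable q : jet (R := R).
Hypothesis Hs : forall i j, jet2 q i j = jet2 q j i.
Notation p := (jet1 q).

(** J times the form H + (a/J) restricted to the plane orthogonal to p,
    extended by zero on p. *)
Definition jL i j := jJ q * jet2 q i j - p i * jHp q j - jHp q i * p j
  + jHpp q * kron i j.

(** By jL_sqr this is J Z times the orthogonal projection onto the kernel of
    jL in the plane orthogonal to p when X = 0. *)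
Definition jproj i k := jJ q * (jZ q * kron i k - jL i k) - jZ q * p i * p k.

Lemma jL_sym i j : jL i j = jL j i.
Proof. by rewrite /jL Hs /kron eq_sym; ring. Qed.

Lemma jL_p i : \sum_j jL i j * p j = 0.
Proof.
move: i; rewrite /jL /jHpp /jHp /jJ; elim/ord3_ind; rewrite !sum3 !kronE
 (Hs o1 o0) (Hs o2 o0) (Hs o2 o1); ring.
Qed.

Lemma jL_trace : \sum_i jL i i = jZ q.
Proof.
by rewrite /jL /jZ /jlap /jHpp /jHp /jJ !sum3 !kronE; ring.
Qed.

(** Cayley-Hamilton for jL on the plane orthogonal to p, where its trace is Z
    and its determinant J X / 2. *)
Lemma jL_sqr i k : 2 * (\sum_j jL i j * jL j k) =
  2 * (jZ q * jL i k) - jX q * (jJ q * kron i k - p i * p k).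
Proof.
move: i k; elim/ord3_ind; elim/ord3_ind;
rewrite /jL /jX /jZ /jHH /jlap /jHpp /jHp /jJ !sum3 !kronE
 (Hs o1 o0) (Hs o2 o0) (Hs o2 o1); ring.
Qed.

Lemma jLwE w i : jperp q w = 0 -> jLw q w i = \sum_j jL i j * w j.
Proof.
move=> perp; transitivity (\sum_j jL i j * w j + jHp q i * jperp q w).
  rewrite /jLw /jL /jHw /jHpw /jperp -!(sum_kron (fun j => jHpp q * w j) i).
  rewrite !sum3; ring.
by rewrite perp mulr0 addr0.
Qed.

Hypothesis X0 : jX q = 0.

Lemma jL_sqr0 i k : \sum_j jL i j * jL j k = jZ q * jL i k.
Proof.
have := jL_sqr i k; rewrite X0 mul0r subr0; apply: mulfI.
by rewrite pnatr_eq0.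
Qed.

(** As jL is symmetric with square Z jL, the squared length of jL w is Z times
    w.(jL w), which is Z J (H(w,w) + a) = 0. *)
Lemma jLw_eq0 w : jperp q w = 0 -> jnorm q w = 0 ->
  \sum_i \sum_j jet2 q i j * w i * w j + jHpp q = 0 ->
  forall i, jLw q w i = 0.
Proof.
move=> perp wnorm null.
have null' : \sum_i w i * jLw q w i = 0.
  rewrite -[RHS](mulr0 (jJ q)) -[X in _ = _ * X]null.
  transitivity (jJ q * (\sum_i \sum_j jet2 q i j * w i * w j) - jHpw q w *
    jperp q w
    + jHpp q * (jnorm q w + jJ q)).
    by rewrite /jLw /jHw /jHpw /jperp /jnorm; rewrite !sum3; ring.
  by rewrite perp wnorm; ring.
have : \sum_i jLw q w i ^+ 2 = 0.
  transitivity (\sum_i w i * (\sum_j (\sum_l jL i l * jL l j) * w j)).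
    rewrite !sum3 !jLwE // !sum3 (jL_sym o1 o0) (jL_sym o2 o0) (jL_sym o2 o1);
      ring.
  under eq_bigr do under eq_bigr do rewrite jL_sqr0 -mulrA.
  under eq_bigr do rewrite -mulr_sumr -jLwE // mulrCA.
  by rewrite -mulr_sumr null' mulr0.
move/eqP; rewrite psumr_eq0 => [|i _]; last exact: sqr_ge0.
by move=> /allP h i; apply/eqP; rewrite -sqrf_eq0; apply: h;
  rewrite mem_index_enum.
Qed.

Lemma jproj_perp k : \sum_i p i * jproj i k = 0.
Proof.
transitivity (- jJ q * (\sum_i jL k i * p i)
    + jZ q * p k * (jJ q - \sum_i p i * p i)); last first.
  by rewrite jL_p /jJ; ring.
by move: k; elim/ord3_ind; rewrite /jproj !sum3 !kronE
  ?(jL_sym o1 o0) ?(jL_sym o2 o0) ?(jL_sym o2 o1); ring.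
Qed.

Lemma jproj_kernel j k : \sum_i jL j i * jproj i k = 0.
Proof.
transitivity (jJ q * (jZ q * jL j k - \sum_i jL j i * jL i k)
    - jZ q * p k * \sum_i jL j i * p i); last first.
  by rewrite jL_p jL_sqr0; ring.
by move: k; elim/ord3_ind; rewrite /jproj !sum3 !kronE; ring.
Qed.

Lemma jproj_norm k : \sum_i jproj i k * jproj i k = jJ q * (jZ q * jproj k k).
Proof.
transitivity (jJ q * (jZ q * jproj k k) - jJ q * (\sum_i jL k i * jproj i k)
    - jZ q * p k * \sum_i p i * jproj i k); last first.
  by rewrite jproj_kernel jproj_perp; ring.
by move: k; elim/ord3_ind; rewrite !sum3 {1 3 5}/jproj !kronE
  ?(jL_sym o1 o0) ?(jL_sym o2 o0) ?(jL_sym o2 o1); ring.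
Qed.

Lemma jproj_trace : \sum_k jproj k k = jJ q * jZ q.
Proof.
transitivity (jJ q * (3 * jZ q - \sum_i jL i i) - jZ q * \sum_i p i * p i).
  by rewrite /jproj !sum3 !kronE; ring.
by rewrite jL_trace -[\sum_i p i * p i]/(jJ q); ring.
Qed.

(** Some diagonal entry of Z jproj is positive because its trace is J Z^2. *)
Lemma jproj_gt0 : 0 < jJ q -> jZ q != 0 -> exists k, 0 < jZ q * jproj k k.
Proof.
move=> J0 Z0; apply/not_existsP => h.
have : \sum_k jZ q * jproj k k <= 0.
  by apply: sumr_le0 => k _; rewrite leNgt; apply/negP/h.
rewrite -mulr_sumr jproj_trace mulrCA -expr2 leNgt.
by rewrite mulr_gt0 // exprn_even_gt0.
Qed.

(** The k-th column of the projection, scaled to length |p|: a choice of null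
    vector that is smooth wherever the square root does not vanish. *)
Definition jkernel k i := jproj i k / Num.sqrt (jZ q * jproj k k).

Lemma jkernel_perp k : jperp q (jkernel k) = 0.
Proof.
rewrite /jperp /jkernel; under eq_bigr do rewrite mulrA.
by rewrite -mulr_suml jproj_perp mul0r.
Qed.

Lemma jkernel_norm k : 0 < jZ q * jproj k k -> jnorm q (jkernel k) = 0.
Proof.
move=> k0; rewrite /jnorm /jkernel; under eq_bigr do rewrite mulf_div.
rewrite -mulr_suml jproj_norm -[X in _ / X]expr2 sqr_sqrtr ?(ltW k0) //.
by rewrite mulfK ?subrr // gt_eqF.
Qed.

Lemma jkernel_Lw k i : jLw q (jkernel k) i = 0.
Proof.
rewrite jLwE ?jkernel_perp // /jkernel; under eq_bigr do rewrite mulrA.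
by rewrite -mulr_suml jproj_kernel mul0r.
Qed.
End kernel.

(** * Smooth functions *)

Section derivation_rules.
Context {R : realType}.
Implicit Types (f g : 'rV[R]_3 -> R) (x v : 'rV[R]_3) (U W : set 'rV[R]_3).

Lemma is_derive_mul f g x v a b : is_derive x v f a -> is_derive x v g b ->
  is_derive x v (fun y => f y * g y) (g x * a + f x * b).
Proof. by move=> hf hg; rewrite addrC; exact: is_deriveM. Qed.

Lemma is_derive_add f g x v a b : is_derive x v f a -> is_derive x v g b ->
  is_derive x v (fun y => f y + g y) (a + b).
Proof. by move=> hf hg; exact: is_deriveD. Qed.

Lemma is_derive_opp f x v a : is_derive x v f a ->
  is_derive x v (fun y => - f y) (- a).
Proof. by move=> hf; exact: is_deriveN. Qed.

Lemma is_derive_scale c f x v a : is_derive x v f a ->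
  is_derive x v (fun y => c * f y) (c * a).
Proof. by move=> hf; exact: is_deriveZ. Qed.

Lemma is_derive_bigsum n (f : 'I_n -> 'rV[R]_3 -> R) x v a :
  (forall i, is_derive x v (f i) (a i)) ->
  is_derive x v (fun y => \sum_i f i y) (\sum_i a i).
Proof.
move=> hf; have -> : (fun y => \sum_i f i y) = \sum_i f i.
  by apply/funext => y; rewrite fct_sumE.
exact: is_derive_sum.
Qed.

Lemma is_derive_line f x v a :
  is_derive x v f a <-> is_derive (0 : R) 1 (fun h : R => f (h *: v + x)) a.
Proof.
have D : 'D_v f x = 'D_1 (fun h : R => f (h *: v + x)) 0.
  rewrite /derive; set g1 := fun h => h^-1 *: _; set g2 := fun h => h^-1 *: _.
  suff -> : g1 = g2 by [].
  by apply/funext => h; rewrite /g1 /g2 /= addr0 scale0r add0r [_%:A]mulr1.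
split=> -[h1 h2]; apply: DeriveDef.
- exact: (derivable1P f x v).1.
- by rewrite -D.
- exact: (derivable1P f x v).2.
- by rewrite D.
Qed.

Lemma is_derive_comp (h : R -> R) f x v a b : is_derive x v f a ->
  is_derive (f x) 1 h b -> is_derive x v (fun y => h (f y)) (b * a).
Proof.
move=> /is_derive_line[fd fa] [hd hb]; apply/is_derive_line.
pose l (t : R) := f (t *: v + x).
have l0 : l 0 = f x by rewrite /l scale0r add0r.
rewrite -/l in fd fa.
have hd' : derivable h (l 0) 1 by rewrite l0.
apply: DeriveDef.
  apply/derivable1_diffP/differentiable_comp; exact/derivable1_diffP.
by rewrite -derive1E (derive1_comp fd hd') !derive1E l0 fa hb.
Qed.

Lemma is_derive_inv f x v a : f x != 0 -> is_derive x v f a ->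
  is_derive x v (fun y => (f y)^-1) (- ((f x)^-1 * (f x)^-1 * a)).
Proof.
move=> f0 [fd fa]; apply: DeriveDef; first exact: derivableV.
by rewrite deriveV // fa expr2 invfM scaleNr.
Qed.

Lemma is_derive_sqrt f x v a : 0 < f x -> is_derive x v f a ->
  is_derive x v (fun y => Num.sqrt (f y)) (2^-1 * (Num.sqrt (f x))^-1 * a).
Proof.
move=> f0 fa; rewrite -invfM; apply: is_derive_comp fa _.
exact: is_derive1_sqrt.
Qed.

Lemma open_near U x (P : 'rV[R]_3 -> Prop) : open U -> U x ->
  (forall y, U y -> P y) -> \forall y \near x, P y.
Proof.
by move=> Uo Ux h; apply: filterS (open_nbhs_nbhs (conj Uo Ux)).
Qed.

Lemma nabla_eq U f g i x : open U -> U x -> (forall y, U y -> f y = g y) ->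
  nabla i f x = nabla i g x.
Proof. by move=> Uo Ux h; apply: near_eq_derive; exact: open_near h. Qed.

Lemma nabla_val f k x a : is_derive x (delta_mx 0 k) f a -> nabla k f x = a.
Proof. by move=> h; exact: derive_val. Qed.

End derivation_rules.

Section smoothness.
Context {R : realType}.
Implicit Types (f g : 'rV[R]_3 -> R) (x v : 'rV[R]_3) (U W : set 'rV[R]_3).

(** Smoothness quantifies over all iterated derivatives at once; closure under
    products and inverses goes by induction on their order. *)
Fixpoint Ck n U f : Prop :=
  (forall x, U x -> {for x, continuous f}) /\
  if n is m.+1 then forall i,
    (forall x, U x -> derivable f x (delta_mx 0 i)) /\
    Ck m U (nabla i f)
  else True.

Lemma smooth_onP U f : smooth_on U f <-> forall n, Ck n U f.
Proof.
split=> [h n|h].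
  elim: n f h => [|n IH] f h; split=> //; first by move=> x /(h [::])[].
    by move=> x /(h [::])[].
  move=> i; split; first by move=> x /(h [::])[_].
  apply: IH => s x Ux; have := h (rcons s i) x Ux.
  by rewrite /nabla_iter foldr_rcons.
move=> s; elim/last_ind: s f h => [|s i IH] f h x Ux.
  split; first by have [+ _] := h 0%N; apply.
  by move=> i; have [_ /(_ i)[+ _]] := h 1%N; apply.
rewrite /nabla_iter foldr_rcons; apply: IH => // n.
by have [_ /(_ i)[]] := h n.+1.
Qed.

Lemma Ck_continuous n U f x : Ck n U f -> U x -> {for x, continuous f}.
Proof. by case: n => [|n] [h _]; exact: h. Qed.

Lemma CkW n U f : Ck n.+1 U f -> Ck n U f.
Proof.
elim: n f => [|n IH] f [fc fd]; split=> // i.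
by have [? h] := fd i; split=> //; exact: IH.
Qed.

Lemma Ck_is_derive n U f i x : Ck n.+1 U f -> U x ->
  is_derive x (delta_mx 0 i) f (nabla i f x).
Proof.
by move=> [_ /(_ i)[h _]] Ux; apply: DeriveDef => //; exact: h.
Qed.

Lemma Ck_eq n U f g : open U -> (forall x, U x -> f x = g x) ->
  Ck n U f -> Ck n U g.
Proof.
move=> Uo; elim: n f g => [|n IH] f g fg [fc fd]; split=> //.
- move=> x Ux; have nfg := open_near Uo Ux fg.
  rewrite /prop_for /continuous_at -(fg x Ux).
  exact: cvg_trans (near_eq_cvg nfg) (fc x Ux).
- move=> x Ux; have nfg := open_near Uo Ux fg.
  rewrite /prop_for /continuous_at -(fg x Ux).
  exact: cvg_trans (near_eq_cvg nfg) (fc x Ux).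
move=> i; have [fdi fn] := fd i; split=> [x Ux|].
  exact: near_eq_derivable (open_near Uo Ux fg) (fdi x Ux).
by apply: IH fn => x Ux; exact: nabla_eq Uo Ux fg.
Qed.

(** It is enough to know the partial derivatives on the open set, since they
    determine nabla there. *)
Lemma Ck_step n U f (df : 'I_3 -> 'rV[R]_3 -> R) : open U ->
  (forall x, U x -> {for x, continuous f}) ->
  (forall i x, U x -> is_derive x (delta_mx 0 i) f (df i x)) ->
  (forall i, Ck n U (df i)) -> Ck n.+1 U f.
Proof.
move=> Uo fc fd dfn; split=> // i; split=> [x Ux|].
  by have [] := fd i x Ux.
by apply: Ck_eq (dfn i) => // x Ux; rewrite (nabla_val (fd i x Ux)).
Qed.

Lemma Ck_cst n U c : open U -> Ck n U (fun=> c).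
Proof.
move=> Uo; elim: n c => [|n IH] c; first by split=> // x _;
  exact: cst_continuous.
apply: (@Ck_step _ _ _ (fun _ _ => 0)) => //.
by move=> x _; exact: cst_continuous.
Qed.

Lemma Ck_add n U f g : open U -> Ck n U f -> Ck n U g ->
  Ck n U (fun x => f x + g x).
Proof.
move=> Uo; elim: n f g => [|n IH] f g hf hg.
  split=> // x Ux; exact: continuousD (Ck_continuous hf Ux)
    (Ck_continuous hg Ux).
apply: (@Ck_step _ _ _ (fun i x => nabla i f x + nabla i g x)) => //.
- by move=> x Ux; exact: continuousD (Ck_continuous hf Ux)
  (Ck_continuous hg Ux).
- by move=> i x Ux; apply: is_derive_add;
  [exact: Ck_is_derive hf Ux|exact: Ck_is_derive hg Ux].
- by move=> i; apply: IH; [case: hf|case: hg] => _ /(_ i)[].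
Qed.

Lemma Ck_mul n U f g : open U -> Ck n U f -> Ck n U g ->
  Ck n U (fun x => f x * g x).
Proof.
move=> Uo; elim: n f g => [|n IH] f g hf hg.
  split=> // x Ux; exact: continuousM (Ck_continuous hf Ux)
    (Ck_continuous hg Ux).
apply: (@Ck_step _ _ _ (fun i x =>
  g x * nabla i f x + f x * nabla i g x)) => //.
- by move=> x Ux; exact: continuousM (Ck_continuous hf Ux)
  (Ck_continuous hg Ux).
- by move=> i x Ux; apply: is_derive_mul;
  [exact: Ck_is_derive hf Ux|exact: Ck_is_derive hg Ux].
- move=> i; apply: Ck_add => //; apply: IH; try exact: CkW.
    by case: hf => _ /(_ i)[].
  by case: hg => _ /(_ i)[].
Qed.

Lemma Ck_opp n U f : open U -> Ck n U f -> Ck n U (fun x => - f x).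
Proof.
move=> Uo hf; apply: Ck_eq (Ck_mul Uo (Ck_cst n (-1) Uo) hf) => // x _.
by rewrite mulN1r.
Qed.

Lemma Ck_inv n U f : open U -> (forall x, U x -> f x != 0) -> Ck n U f ->
  Ck n U (fun x => (f x)^-1).
Proof.
move=> Uo f0; elim: n => [|n IH] hf.
  by split=> // x Ux; apply: continuousV (f0 x Ux) (Ck_continuous hf Ux).
apply: (@Ck_step _ _ _ (fun i x => - ((f x)^-1 *
  (f x)^-1 * nabla i f x))) => //.
- by move=> x Ux; apply: continuousV (f0 x Ux) (Ck_continuous hf Ux).
- by move=> i x Ux; apply: is_derive_inv; [exact: f0|exact: Ck_is_derive hf Ux].
- move=> i; have Vn := IH (CkW hf); apply: Ck_opp => //.
  apply: Ck_mul => //; first exact: Ck_mul.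
  by case: hf => _ /(_ i)[].
Qed.

Lemma Ck_sqrt n U f : open U -> (forall x, U x -> 0 < f x) -> Ck n U f ->
  Ck n U (fun x => Num.sqrt (f x)).
Proof.
move=> Uo f0; have fc m : Ck m U f -> forall x, U x ->
    {for x, continuous (fun x => Num.sqrt (f x))}.
  move=> hf x Ux; apply: continuous_comp (Ck_continuous hf Ux) _.
  exact: sqrt_continuous.
elim: n => [|n IH] hf; first by split=> //; exact: fc hf.
apply: (@Ck_step _ _ _ (fun i x => 2^-1 * (Num.sqrt
  (f x))^-1 * nabla i f x)) => //.
- exact: fc hf.
- by move=> i x Ux; apply: is_derive_sqrt;
  [exact: f0|exact: Ck_is_derive hf Ux].
- move=> i; apply: Ck_mul => //; last by case: hf => _ /(_ i)[].
  apply: Ck_mul => //; first exact: Ck_cst.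
  apply: Ck_inv => //; last exact: IH (CkW hf).
  by move=> x Ux; rewrite sqrtr_eq0 -ltNge f0.
Qed.

Lemma Ck_sum n U m (f : 'I_m -> 'rV[R]_3 -> R) : open U ->
  (forall i, Ck n U (f i)) -> Ck n U (fun x => \sum_i f i x).
Proof.
move=> Uo hf; elim: m f hf => [|m IH] f hf.
  by apply: Ck_eq (Ck_cst n 0 Uo) => // x _; rewrite big_ord0.
apply: Ck_eq (Ck_add Uo (hf ord0) (IH (fun i => f (lift ord0 i)) _)) => //.
by move=> x _; rewrite big_ord_recl.
Qed.

Lemma smooth_onW U W f : W `<=` U -> smooth_on U f -> smooth_on W f.
Proof. by move=> WU h s x /WU; exact: h. Qed.

Lemma smooth_on_nabla U f i : smooth_on U f -> smooth_on U (nabla i f).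
Proof.
by move=> /smooth_onP h; apply/smooth_onP => n; have [_ /(_ i)[]] := h n.+1.
Qed.

Lemma smooth_is_derive U f i x : smooth_on U f -> U x ->
  is_derive x (delta_mx 0 i) f (nabla i f x).
Proof. by move=> /smooth_onP /(_ 1%N); exact: Ck_is_derive. Qed.

Lemma smooth_continuous U f x : smooth_on U f -> U x -> {for x, continuous f}.
Proof. by move=> /(_ [::] x) h Ux; have [] := h Ux. Qed.

End smoothness.

(** * Symmetry of second derivatives *)

Section schwarz.
Context {R : realType}.
Implicit Types (f g : 'rV[R]_3 -> R) (x u v : 'rV[R]_3).

Lemma is_derive_along f x v (t : R) a : is_derive (t *: v + x) v f a ->
  is_derive t 1 (fun s : R => f (s *: v + x)) a.
Proof.
have E : (fun h : R => h^-1 *: (f (h *: v + (t *: v + x)) - f (t *: v + x))) =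
   (fun h : R => h^-1 *: (f ((h *: (1 : R) + t) *: v + x) - f (t *: v + x))).
  by apply/funext => h; rewrite scalerDl [h *: 1]mulr1 addrA.
move=> [fd fa]; apply: DeriveDef.
  by move: fd; rewrite /derivable /= E.
by move: fa; rewrite /derive /= E.
Qed.

Lemma mvt_along f df x v (h : R) : 0 < h ->
  (forall t : R, 0 <= t <= h -> is_derive (t *: v + x) v f (df (t *: v + x))) ->
  exists2 t, 0 < t < h & f (h *: v + x) - f x = df (t *: v + x) * h.
Proof.
move=> h0 fd; pose g (t : R) := f (t *: v + x).
have gd t : 0 <= t <= h -> is_derive t 1 g (df (t *: v + x)).
  by move=> /fd; exact: is_derive_along.
have gc : {within `[0, h], continuous g}.
  apply: derivable_within_continuous => t; rewrite in_itv /= => /gd.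
  by case.
have [|t] := @MVT R g (fun t => df (t *: v + x)) 0 h h0 _ gc.
  by move=> t; rewrite in_itv /= => /andP[t0 th]; apply: gd; rewrite !ltW.
rewrite in_itv /= => t0h; rewrite /g scale0r add0r subr0 => e.
by exists t.
Qed.

(** The mean value theorem, used first along u for f(. + h v) - f and then
    along v for the derivative of f along u. *)
Lemma second_difference f fu fuv x u v (B : set 'rV[R]_3) (h : R) : 0 < h ->
  (forall s t : R, 0 <= s <= h -> 0 <= t <= h -> B (s *: u + (t *: v + x))) ->
  (forall y, B y -> is_derive y u f (fu y)) ->
  (forall y, B y -> is_derive y v fu (fuv y)) ->
  exists2 y, B y & f (h *: u + (h *: v + x)) - f (h *: v + x)
    - (f (h *: u + x) - f x) = fuv y * h * h.
Proof.
move=> h0 hB fd fud.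
have hh : 0 <= h <= h by rewrite lexx ltW.
have h00 : (0 : R) <= 0 <= h by rewrite lexx ltW.
pose g y := f (h *: v + y) - f y.
have [|s /andP[s0 sh] e] := @mvt_along g (fun y => fu
  (h *: v + y) - fu y) x u h h0.
  move=> t t0h.
  have h1 : is_derive (t *: u + x) u (fun y => f (h *: v + y))
      (fu (h *: v + (t *: u + x))).
    have /fd/is_derive_line h1 := hB t h t0h hh.
    apply/is_derive_line; rewrite addrCA.
    have -> // : (fun h1 : R => f (h *: v + (h1 *: u + (t *: u + x)))) =
      (fun h1 : R => f (h1 *: u + (t *: u + (h *: v + x)))).
    apply/funext => k; congr f; rewrite addrCA; congr (_ + _); exact: addrCA.
  have h2 : is_derive (t *: u + x) u f (fu (t *: u + x)).
    by have := hB t 0 t0h h00; rewrite scale0r add0r; exact: fd.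
  exact: is_derive_add h1 (is_derive_opp h2).
have s0h : 0 <= s <= h by rewrite !ltW.
have [|t /andP[t0 th] e'] := @mvt_along fu fuv (s *: u + x) v h h0.
  by move=> t t0h; apply: fud; rewrite addrCA; exact: hB.
exists (t *: v + (s *: u + x)).
  by rewrite addrCA; apply: hB => //; rewrite !ltW.
by rewrite -e' -e /g [h *: u + (h *: v + x)]addrCA; ring.
Qed.

(** The second difference is symmetric in u and v, so that it equals h^2 times
    either mixed derivative at some point close to x. *)
Lemma mixed_derivatives f fu fv fuv fvu x u v :
  (\forall y \near x, is_derive y u f (fu y)) ->
  (\forall y \near x, is_derive y v f (fv y)) ->
  (\forall y \near x, is_derive y v fu (fuv y)) ->
  (\forall y \near x, is_derive y u fv (fvu y)) ->
  {for x, continuous fuv} -> {for x, continuous fvu} -> fuv x = fvu x.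
Proof.
move=> n1 n2 n3 n4 cuv cvu; apply/eqP; rewrite -subr_eq0 -normr_le0.
apply/ler_addgt0Pl => e e0; rewrite addr0.
have e2 : 0 < e / 2 by rewrite divr_gt0.
have n5 : \forall y \near x, `|fuv x - fuv y| < e / 2.
  by move/cvgrPdist_lt : cuv; apply.
have n6 : \forall y \near x, `|fvu x - fvu y| < e / 2.
  by move/cvgrPdist_lt : cvu; apply.
have [d /= d0 hB] := (nbhs_ballP _ _).1 (filterI (filterI (filterI n1 n2)
  (filterI n3 n4)) (filterI n5 n6)).
(* With this h the parallelogram spanned by h u and h v stays in the ball. *)
pose h := d / (1 + `|u| + `|v|) / 2.
have uv0 : 0 < 1 + `|u| + `|v|.
  by rewrite -addrA ltr_pwDl // addr_ge0.
have h0 : 0 < h by rewrite !divr_gt0.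
have inB s t : 0 <= s <= h -> 0 <= t <= h -> ball x d (s *: u + (t *: v + x)).
  move=> /andP[s0 sh] /andP[t0 th].
  rewrite -ball_normE /ball_ /= distrC addrA addrK.
  apply: le_lt_trans (ler_normD _ _) _; rewrite !normrZ !ger0_norm //.
  apply: (@le_lt_trans _ _ (h * (1 + `|u| + `|v|))).
    have := ler_wpM2r (normr_ge0 u) sh; have := ler_wpM2r (normr_ge0 v) th.
    by rewrite !mulrDr mulr1; move: h0; lra.
  by rewrite /h mulrAC divfK ?gt_eqF // ltr_pdivrMr // ltr_pMr // ltr1n.
have [y1 By1 E1] := @second_difference f fu fuv x u v (ball x d) h h0 inB
  (fun y By => (hB y By).1.1.1) (fun y By => (hB y By).1.2.1).
have inB' s t : 0 <= s <= h -> 0 <= t <= h -> ball x d (s *: v + (t *: u + x)).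
  by move=> s0 t0; rewrite addrCA; exact: inB.
have [y2 By2 E2] := @second_difference f fv fvu x v u (ball x d) h h0 inB'
  (fun y By => (hB y By).1.1.2) (fun y By => (hB y By).1.2.2).
have E : fuv y1 = fvu y2.
  apply: (mulIf (lt0r_neq0 h0)); apply: (mulIf (lt0r_neq0 h0)).
  by rewrite -E1 -E2 [h *: v + (h *: u + x)]addrCA; ring.
have := (hB _ By1).2.1; have := (hB _ By2).2.2; rewrite E => a2 a1.
rewrite (_ : fuv x - fvu x = (fuv x - fvu y2) - (fvu x - fvu y2)); last by ring.
apply: le_trans (ler_normB _ _) _; rewrite [e]splitr.
by rewrite lerD // ltW.
Qed.

Lemma nabla_nablaC U f i j x : open U -> smooth_on U f -> U x ->
  nabla i (nabla j f) x = nabla j (nabla i f) x.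
Proof.
move=> Uo sf Ux.
have sd k := smooth_on_nabla k sf.
apply: (@mixed_derivatives f (nabla j f) (nabla i f) _ _ x
  (delta_mx 0 j) (delta_mx 0 i)); try apply: open_near Uo Ux _ => y Uy.
- exact: smooth_is_derive sf Uy.
- exact: smooth_is_derive sf Uy.
- exact: smooth_is_derive (sd _) Uy.
- exact: smooth_is_derive (sd _) Uy.
- exact: smooth_continuous (smooth_on_nabla _ (sd _)) Ux.
- exact: smooth_continuous (smooth_on_nabla _ (sd _)) Ux.
Qed.

End schwarz.

(** * Functions with continuous partial derivatives *)

Section c1.
Context {R : realType}.
Implicit Types (f g : 'rV[R]_3 -> R) (x u v : 'rV[R]_3).
Notation e_ i := (delta_mx 0 i : 'rV[R]_3).

Lemma coord_le_norm v i : `|v 0 i| <= `|v|.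
Proof.
rewrite [leRHS]/Num.norm /= mx_normrE; apply/bigmax_geP; right => /=.
by exists (0, i).
Qed.

Lemma norm_delta i : `|e_ i| <= 1.
Proof.
have -> : `|e_ i| = mx_norm (e_ i) by [].
rewrite mx_normrE; apply: bigmax_le => [//|[a b] _] /=.
by rewrite mxE; case: (_ && _); rewrite ?normr1 ?normr0.
Qed.

(** For negative h the mean value theorem is applied from the other end. *)
Lemma mvt_along_signed f df x v (h : R) :
  (forall t : R, `|t| <= `|h| -> is_derive (t *: v + x) v f (df
    (t *: v + x))) ->
  exists2 t, `|t| <= `|h| & f (h *: v + x) - f x = df (t *: v + x) * h.
Proof.
move=> fd; have [h0|h0|->] := ltgtP h 0; last first.
- by exists 0; rewrite // scale0r add0r subrr mulr0.
- have [|t /andP[t0 th] e] := mvt_along (df := df) (x := x) h0 (f := f) (v :=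
  v).
    move=> t /andP[t0 th]; apply: fd; rewrite !ger0_norm //.
    exact: le_trans th.
  exists t => //; rewrite !ger0_norm ?ltW //.
have h0' : 0 < - h by rewrite oppr_gt0.
have [|t /andP[t0 th] e] := @mvt_along R f df (h *: v + x) v (- h) h0'.
  move=> t /andP[t0 th]; rewrite addrA -scalerDl; apply: fd.
  by rewrite !ler0_norm ?(ltW h0) //; move: t0 th; lra.
exists (t + h); first by rewrite !ler0_norm ?(ltW h0) //; move: t0 th; lra.
move: e; rewrite !addrA -!scalerDl addNr scale0r add0r => e.
by rewrite -[LHS]opprB e mulrN opprK.
Qed.

Variables (f : 'rV[R]_3 -> R) (df : 'I_3 -> 'rV[R]_3 -> R) (x : 'rV[R]_3).
Hypothesis fd : forall i, \forall y \near x, is_derive y (e_ i) f (df i y).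
Hypothesis dfc : forall i, {for x, continuous (df i)}.

Lemma row3E v : v = v 0 o2 *: e_ o2 + (v 0 o1 *: e_ o1 + v 0 o0 *: e_ o0).
Proof.
rewrite {1}(row_sum_delta v) !big_ord_recr big_ord0 /= add0r.
rewrite addrC; congr (_ + _); first by congr (v 0 _ *: e_ _); exact: val_inj.
by rewrite addrC; congr (_ + _); congr (v 0 _ *: e_ _); exact: val_inj.
Qed.

(** From x to v + x one moves along one coordinate axis after the other; the
    mean value theorem on each leg gives a partial derivative at a nearby
    point. *)
Lemma c1_increment e : 0 < e -> \forall v \near (0 : 'rV[R]_3),
  `|f (v + x) - f x - \sum_i v 0 i * df i x| <= e * `|v|.
Proof.
move=> e0; have e3 : 0 < e / 3 by rewrite divr_gt0.
have N i : \forall y \near x, is_derive y (e_ i) f (df i y) /\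
    `|df i x - df i y| < e / 3.
  apply: filterI; first exact: fd.
  by have /cvgrPdist_lt := @dfc i; apply.
have [d /= d0 hB] := (nbhs_ballP _ _).1 (filterI (N o0) (filterI (N o1)
  (N o2))).
have inB v (t r s : R) : `|v| < d / 3 -> `|t| <= `|v| -> `|r| <= `|v| ->
    `|s| <= `|v| -> ball x d (t *: e_ o2 + (r *: e_ o1 + (s *: e_ o0 + x))).
  move=> vd tv rv sv; rewrite -ball_normE /ball_ /= distrC !addrA addrK.
  have H (c : R) i : `|c| <= `|v| -> `|c *: e_ i| <= `|v|.
    move=> cv; rewrite normrZ; apply: le_trans cv.
    by rewrite ler_piMr // norm_delta.
  apply: le_lt_trans (ler_normD _ _) _.
  have := ler_normD (t *: e_ o2) (r *: e_ o1).
  have := H t o2 tv; have := H r o1 rv; have := H s o0 sv; move: vd; lra.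
apply/nbhs_ballP; exists (d / 3) => /=; first by rewrite divr_gt0.
move=> v; rewrite -ball_normE /ball_ /= sub0r normrN => vd.
have c i := coord_le_norm v i.
have z0 : `|0 : R| <= `|v| by rewrite normr0.
have [|t0 t0v E0] := @mvt_along_signed f (df o0) x (e_ o0) (v 0 o0).
  move=> t tv; have := inB v 0 0 t vd z0 z0 (le_trans tv (c _)).
  by rewrite !scale0r !add0r => /hB[[]].
have [|t1 t1v E1] := @mvt_along_signed f (df o1) (v 0 o0 *: e_ o0 + x) (e_ o1)
  (v 0 o1).
  move=> t tv; have := inB v 0 t _ vd z0 (le_trans tv (c _)) (c o0).
  by rewrite !scale0r !add0r => /hB[_ [[]]].
have [|t2 t2v E2] := @mvt_along_signed f (df o2)
    (v 0 o1 *: e_ o1 + (v 0 o0 *: e_ o0 + x)) (e_ o2) (v 0 o2).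
  move=> t tv; have := inB v t _ _ vd (le_trans tv (c _)) (c o1) (c o0).
  by move=> /hB[_ [_ []]].
have D0 : `|df o0 x - df o0 (t0 *: e_ o0 + x)| < e / 3.
  have := inB v 0 0 t0 vd z0 z0 (le_trans t0v (c _)).
  by rewrite !scale0r !add0r => /hB[[]].
have D1 : `|df o1 x - df o1 (t1 *: e_ o1 + (v 0 o0 *: e_ o0 + x))| < e / 3.
  have := inB v 0 t1 _ vd z0 (le_trans t1v (c _)) (c o0).
  by rewrite !scale0r !add0r => /hB[_ [[]]].
have D2 : `|df o2 x - df o2 (t2 *: e_ o2 + (v 0 o1 *: e_ o1 +
  (v 0 o0 *: e_ o0 + x)))| < e / 3.
  have := inB v t2 _ _ vd (le_trans t2v (c _)) (c o1) (c o0).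
  by move=> /hB[_ [_ []]].
have Dc (a b : R) i : `|a - b| < e / 3 -> `|(b - a) * v 0 i| <= e / 3 * `|v|.
  by move=> ab; rewrite normrM distrC ler_pM // ltW.
have -> : v + x = v 0 o2 *: e_ o2 + (v 0 o1 *: e_ o1 + (v 0 o0 *: e_ o0 + x)).
  by rewrite {1}(row3E v) -!addrA.
rewrite sum3.
rewrite (_ : _ - _ = (df o0 (t0 *: e_ o0 + x) - df o0 x) * v 0 o0 +
   (df o1 (t1 *: e_ o1 + (v 0 o0 *: e_ o0 + x)) - df o1 x) * v 0 o1 +
   (df o2 (t2 *: e_ o2 + (v 0 o1 *: e_ o1 + (v 0 o0 *: e_ o0 + x))) - df o2 x)
      * v 0 o2); last first.
  by rewrite !mulrBl -E0 -E1 -E2; ring.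
apply: le_trans (ler_normD _ _) _.
have := ler_normD ((df o0 (t0 *: e_ o0 + x) - df o0 x) * v 0 o0)
   ((df o1 (t1 *: e_ o1 + (v 0 o0 *: e_ o0 + x)) - df o1 x) * v 0 o1).
have := Dc _ _ o0 D0; have := Dc _ _ o1 D1; have := Dc _ _ o2 D2.
lra.
Qed.

Lemma c1_is_derive v : is_derive x v f (\sum_i v 0 i * df i x).
Proof.
have cv : h^-1 *: (f (h *: v + x) - f x) @[h --> 0^'] --> \sum_i v 0 i * df i x.
  apply/cvgrPdist_le => e e0.
  have e1 : 0 < e / (1 + `|v|) by rewrite divr_gt0 // ltr_pwDl.
  have N : \forall h \near (0 : R), `|f (h *: v + x) - f x -
      \sum_i (h *: v) 0 i * df i x| <= e / (1 + `|v|) * `|h *: v|.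
    have cz : (fun h : R => h *: v) @ (0 : R) --> (0 : 'rV[R]_3).
      by rewrite -[X in _ --> X](scale0r v); exact: scalel_continuous.
    exact: cz (c1_increment e1).
  near=> h.
  have h0 : h != 0 by near: h; exact: nbhs_dnbhs_neq.
  have Nh : `|f (h *: v + x) - f x - \sum_i (h *: v) 0 i * df i x|
      <= e / (1 + `|v|) * `|h *: v| by near: h; exact: nbhs_dnbhs.
  have -> : \sum_i v 0 i * df i x - h^-1 *: (f (h *: v + x) - f x) =
    - h^-1 * (f (h *: v + x) - f x - \sum_i (h *: v) 0 i * df i x).
    under [in RHS]eq_bigr do rewrite mxE -mulrA.
    by rewrite -mulr_sumr -[_ *: _]/(_ * _); field.
  rewrite normrM normrN normfV ler_pdivrMl ?normr_gt0 //.
  apply: le_trans Nh _; rewrite normrZ mulrCA ler_pM2l ?normr_gt0 //.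
  rewrite mulrAC ler_pdivrMr ?ltr_pwDl // ler_pM2l //.
  by rewrite lerDr.
have fder : derivable f x v by apply/cvg_ex; eexists; exact: cv.
by apply: DeriveDef => //; exact: cvg_lim cv.
Unshelve. all: by end_near. Qed.

Lemma c1_continuous : {for x, continuous f}.
Proof.
pose K := 1 + \sum_i `|df i x|.
have K0 : 0 < K by rewrite ltr_pwDl // sumr_ge0.
apply/(@cvgrPdist_le _ _ _ (nbhs x) (nbhs_filter x) f (f x)) => e e0.
have N : \forall y \near x, `|y - x| < e / K.
  apply/nbhs_ballP; exists (e / K) => /=; first by rewrite divr_gt0.
  by move=> y; rewrite -ball_normE /ball_ /= distrC.
have N2 : \forall y \near x, `|f y - f x - \sum_i (y - x) 0 i * df i x|
  <= `|y - x|.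
  have [d /= d0 hd] := (nbhs_ballP _ _).1 (c1_increment ltr01).
  apply/nbhs_ballP; exists d => //= y; rewrite -ball_normE /ball_ /= distrC =>
    yd.
  have := hd (y - x); rewrite -ball_normE /ball_ /= sub0r normrN subrK mul1r.
  exact.
apply: filterS2 N N2 => y yx h.
rewrite distrC (_ : f y - f x = (f y - f x - \sum_i (y - x) 0 i * df i x)
  + \sum_i (y - x) 0 i * df i x); last by rewrite subrK.
apply: le_trans (ler_normD _ _) _.
apply: (@le_trans _ _ (`|y - x| * K)); last first.
  by rewrite -ler_pdivlMr // ltW.
rewrite /K mulrDr mulr1 lerD // mulr_sumr; apply: le_trans
  (ler_norm_sum _ _ _) _.
apply: ler_sum => i _; rewrite normrM ler_wpM2r //; exact: coord_le_norm.
Qed.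

End c1.

(** * The Poincare lemma *)

Section smooth_derive.
Context {R : realType}.
Implicit Types (f g : 'rV[R]_3 -> R) (x u v : 'rV[R]_3) (U : set 'rV[R]_3).

Lemma smooth_is_derive_dir U f x v : open U -> smooth_on U f -> U x ->
  is_derive x v f (\sum_i v 0 i * nabla i f x).
Proof.
move=> Uo sf Ux; apply: (@c1_is_derive R f (fun i => nabla i f)) => i.
  by apply: open_near Uo Ux _ => y; exact: smooth_is_derive.
exact: smooth_continuous (smooth_on_nabla i sf) Ux.
Qed.

(** The continuity of g itself comes from that of its partial derivatives. *)
Lemma smooth_on_potential U g (w : 'I_3 -> 'rV[R]_3 -> R) : open U ->
  (forall i, smooth_on U (w i)) ->
  (forall i x, U x -> is_derive x (delta_mx 0 i) g (w i x)) -> smooth_on U g.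
Proof.
move=> Uo sw gw.
have gc x : U x -> {for x, continuous g}.
  move=> Ux; apply: (@c1_continuous R g w) => i.
    by apply: open_near Uo Ux _; exact: gw.
  exact: smooth_continuous (sw i) Ux.
apply/smooth_onP => -[|n]; first by split=> // x; exact: gc.
apply: Ck_step Uo _ gw _; first by move=> x; exact: gc.
by move=> i; exact: (smooth_onP _ _).1 (sw i) n.
Qed.

End smooth_derive.

Section poincare.
Context {R : realType}.
Implicit Types (x y z v : 'rV[R]_3).
Notation e_ i := (delta_mx 0 i : 'rV[R]_3).
Variables (U : set 'rV[R]_3) (w : 'I_3 -> 'rV[R]_3 -> R) (p : 'rV[R]_3).
Hypotheses (Uo : open U) (sw : forall i, smooth_on U (w i)).
Hypothesis closed : forall i j x, U x -> nabla i (w j) x = nabla j (w i) x.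
Variables (r M : R).
Hypothesis (rU : ball p r `<=` U).
Hypothesis wM : forall i x, ball p r x -> `|w i x| <= M.
Hypothesis dwM : forall i j x, ball p r x -> `|nabla i (w j) x| <= M.

Let mu := @lebesgue_measure R.
Let seg z (t : R) := t *: (z - p) + p.
Let integrand z (t : R) := \sum_i w i (seg z t) * (z - p) 0 i.
(** The integral of w along the segment from p to z. *)
Definition potential z := (\int[mu]_(t in `[0, 1]) integrand z t)%R.

Let seg_ball z (t : R) : ball p r z -> 0 <= t <= 1 -> ball p r (seg z t).
Proof.
rewrite -!ball_normE /ball_ /= => zr /andP[t0 t1].
rewrite /seg opprD addrCA subrr addr0 normrN normrZ ger0_norm //.
by apply: le_lt_trans zr; rewrite distrC ler_piMl.
Qed.

Let is_derive_seg f z (t : R) : smooth_on U f -> ball p r z -> 0 <= t <= 1 ->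
  is_derive t 1 (fun t : R => f (seg z t))
    (\sum_j (z - p) 0 j * nabla j f (seg z t)).
Proof.
move=> sf zr t01; apply: is_derive_along; apply: smooth_is_derive_dir Uo sf _.
exact/rU/seg_ball.
Qed.

Let dintegrand k z (t : R) := \sum_i ((z - p) 0 i * (t * nabla k (w i)
  (seg z t))
  + w i (seg z t) * kron k i).

Let is_derive_integrand k z (t : R) : ball p r z -> 0 <= t <= 1 ->
  is_derive z (e_ k) (fun z => integrand z t) (dintegrand k z t).
Proof.
move=> zr t01; apply: is_derive_bigsum => i; apply: is_derive_mul.
  have Us : U (seg z t) by exact/rU/seg_ball.
  have := @smooth_is_derive_dir R U (w i) (seg z t) (t *: e_ k) Uo (sw i) Us.
  have -> : \sum_j (t *: e_ k) 0 j * nabla j (w i) (seg z t) = t * nabla k (w i)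
    (seg z t).
    rewrite (bigD1 k) //= big1 ?addr0; first by rewrite !mxE !eqxx mulr1.
    by move=> j jk; rewrite !mxE eqxx /= (negPf jk) mulr0 mul0r.
  move=> /is_derive_line h; apply/is_derive_line; move: h.
  congr (is_derive _ _ _ _); apply/funext => h; congr (w i).
  by rewrite /seg -[h *: _ + z - p]addrA [t *: (h *: _ + _)]scalerDr
    -[RHS]addrA !scalerA (mulrC t).
apply/is_derive_line.
have -> : (fun h : R => (h *: e_ k + z - p) 0 i) = (fun h : R => kron k i * h +
  (z - p) 0 i).
  by apply/funext => h; rewrite -addrA !mxE eqxx /= /kron eq_sym mulrC.
have h1 := is_deriveZ (kron k i : R) (is_derive_id (0 : R) (1 : R)).
have h2 := is_deriveD h1 (is_derive_cst ((z - p) 0 i) (0 : R) (1 : R)).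
by move: h2; rewrite addr0 [_ *: 1]mulr1.
Qed.

Let continuous_01 (f : R -> R) : (forall t : R, 0 <= t <= 1 -> {for t,
  continuous f}) ->
  {within `[0, 1], continuous f}.
Proof.
by move=> fc; apply: continuous_in_subspaceT => t; rewrite inE /= in_itv /= =>
  /fc.
Qed.

Let continuous_seg f z (t : R) : smooth_on U f -> ball p r z -> 0 <= t <= 1 ->
  {for t, continuous (fun t : R => f (seg z t))}.
Proof.
move=> sf zr t01; have [/derivable1_diffP + _] := is_derive_seg sf zr t01.
exact: differentiable_continuous.
Qed.

Let continuous_sum01 (f : 'I_3 -> R -> R) (t : R) :
  (forall i, {for t, continuous (f i)}) ->
  {for t, continuous (fun t => \sum_i f i t)}.
Proof.
move=> fc; rewrite (_ : (fun t => _) = (fun t => f o0 t + f o1 t + f o2 t)).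
  by apply: continuousD; first apply: continuousD.
by apply/funext => s; rewrite sum3.
Qed.

Let cintegrand z : ball p r z -> {within `[0, 1], continuous (integrand z)}.
Proof.
move=> zr; apply: continuous_01 => t t01; apply: continuous_sum01 => i.
by apply: continuousM; [exact: continuous_seg|exact: cst_continuous].
Qed.

Let cdintegrand k z : ball p r z -> {within `[0, 1], continuous
  (dintegrand k z)}.
Proof.
move=> zr; apply: continuous_01 => t t01; apply: continuous_sum01 => i.
apply: continuousD; last first.
  by apply: continuousM; [exact: continuous_seg|exact: cst_continuous].
apply: continuousM; first exact: cst_continuous.
apply: continuousM; first exact: id.
by apply: continuous_seg => //; exact: smooth_on_nabla.
Qed.

Let dintegrand_le k z t : ball p r z -> 0 <= t <= 1 ->
  `|dintegrand k z t| <= 3 * (r * M + M).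
Proof.
move=> zr t01; have Bs := seg_ball zr t01; case/andP: t01 => t0 t1.
have M0 : 0 <= M by exact: le_trans (normr_ge0 _) (wM o0 Bs).
apply: le_trans (ler_norm_sum _ _ _) _.
apply: (@le_trans _ _ (\sum_(i < 3) (r * M + M))); last first.
  by rewrite sumr_const card_ord mulr_natl.
apply: ler_sum => i _; apply: le_trans (ler_normD _ _) _; rewrite !normrM.
apply: lerD.
  apply: ler_pM => //.
  - apply: le_trans (coord_le_norm _ _) _; rewrite distrC ltW //.
    by move: zr; rewrite -ball_normE.
  - by rewrite -[leRHS]mul1r ler_pM ?dwM // ger0_norm.
rewrite -[leRHS]mulr1 ler_pM ?wM // /kron.
by case: eqP; rewrite ?normr1 ?normr0.
Qed.

(** For closed w the derivative of the integrand with respect to the end point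
    is the derivative of t |-> t w_k(p + t (x - p)). *)
Let integral_dintegrand k x : ball p r x ->
  (\int[mu]_(t in `[0, 1]) dintegrand k x t)%R = w k x.
Proof.
move=> xr; pose F (t : R) := t * w k (seg x t).
have dF (t : R) : 0 <= t <= 1 -> is_derive t 1 F (dintegrand k x t).
  move=> t01; have Us : U (seg x t) by exact/rU/seg_ball.
  have := is_deriveM (is_derive_id t (1 : R)) (is_derive_seg (sw k) xr t01).
  rewrite [_ *: 1]mulr1 -[t *: _]/(t * _).
  congr (is_derive _ _ _ _).
  rewrite mulr_sumr -[w k _](sum_kron (fun i => w i (seg x t))) -big_split.
  apply: eq_bigr => i _ /=; rewrite closed //; ring.
have cF (t : R) : 0 <= t <= 1 -> {for t, continuous F}.
  by move=> /dF[/derivable1_diffP + _]; exact: differentiable_continuous.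
have := @continuous_FTC2 R (dintegrand k x) F 0 1 ltr01 (cdintegrand xr).
rewrite /Rintegral => ->;
  first by rewrite /F mul0r mul1r sube0 /= /seg scale1r subrK.
- split.
  + by move=> t; rewrite in_itv /= => /andP[/ltW t0 /ltW t1]; have [] := dF t;
    rewrite ?t0.
  + by apply: cvg_at_right_filter; apply: cF; rewrite lexx ler01.
  + by apply: cvg_at_left_filter; apply: cF; rewrite lexx ler01.
- move=> t; rewrite in_itv /= => /andP[/ltW t0 /ltW t1].
  by rewrite derive1E; have [|_ ->] := dF t; rewrite ?t0.
Qed.

Lemma potential_is_derive k x : ball p r x -> is_derive x (e_ k) potential
  (w k x).
Proof.
move=> xr; apply/is_derive_line.
pose d := r - `|p - x|.
have d0 : 0 < d by rewrite subr_gt0; move: xr; rewrite -ball_normE.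
pose u (h t : R) := integrand (h *: e_ k + x) t.
have hr (h : R) : h \in `]-d, d[ -> ball p r (h *: e_ k + x).
  rewrite in_itv /= -ltr_norml => hd; rewrite -ball_normE /ball_ /=.
  rewrite opprD addrCA addrC; apply: le_lt_trans (ler_normB _ _) _.
  have : `|h *: e_ k| < d.
    by apply: le_lt_trans hd; rewrite normrZ ler_piMr // norm_delta.
  by rewrite /d; lra.
have du (h t : R) : h \in `]-d, d[ -> 0 <= t <= 1 ->
    is_derive h 1 (u ^~ t) (dintegrand k (h *: e_ k + x) t).
  move=> /hr hB t01; exact: is_derive_along (is_derive_integrand k hB t01).
have I0 : `]-d, d[%classic 0 by rewrite /= in_itv /= oppr_lt0 d0.
have m01 : measurable (`[0, 1]%classic : set (measurableTypeR R)).
  exact: measurable_itv.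
pose G := fun t : R => 3 * (r * M + M).
have intu h : `]-d, d[%classic h -> mu.-integrable `[0, 1] (EFin \o u h).
  move=> /= hd; apply: continuous_compact_integrable;
    first exact: segment_compact.
  exact: cintegrand (hr _ hd).
have deru h t : `]-d, d[%classic h -> `[0, 1]%classic t -> derivable
  (u ^~ t) h 1.
  by rewrite /= => hd; rewrite in_itv /= => /(du _ _ hd)[].
have G0 : forall t, 0 <= G t.
  move=> t; have t01 : 0 <= (0 : R) <= 1 by rewrite lexx ler01.
  exact: le_trans (normr_ge0 _) (dintegrand_le k xr t01).
have intG : mu.-integrable `[0, 1] (EFin \o G).
  apply: continuous_compact_integrable; first exact: segment_compact.
  by apply: continuous_subspaceT; exact: cst_continuous.
have dE h t : `]-d, d[%classic h -> `[0, 1]%classic t ->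
    partial1of2 u h t = dintegrand k (h *: e_ k + x) t.
  rewrite /= => hd; rewrite in_itv /= => /(du _ _ hd)[_ <-].
  by rewrite partial1of2E.
have Gub h t : `]-d, d[%classic h -> `[0, 1]%classic t -> `|partial1of2 u h t|
  <= G t.
  move=> hd t01; rewrite dE //; apply: dintegrand_le; first exact: hr.
  by move: t01; rewrite /= in_itv.
apply: DeriveDef.
  exact: (derivable_under_integral m01 I0 intu deru G0 intG Gub).
rewrite -derive1E (differentiation_under_integral m01 I0 intu deru G0 intG Gub).
rewrite -(integral_dintegrand k xr); apply: eq_Rintegral => t; rewrite inE =>
  t01.
by rewrite dE // scale0r add0r.
Qed.
End poincare.

Section poincare_lemma.
Context {R : realType}.

(** The ball is chosen inside U and small enough for w and its first
    derivatives to be bounded on it, which is the domination needed to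
    differentiate under the integral sign. *)
Lemma poincare (U : set 'rV[R]_3) (w : 'I_3 -> 'rV[R]_3 -> R) p : open U ->
  U p ->
  (forall i, smooth_on U (w i)) ->
  (forall i j x, U x -> nabla i (w j) x = nabla j (w i) x) ->
  exists (W : set 'rV[R]_3) (g : 'rV[R]_3 -> R),
    [/\ open W, W p, W `<=` U, smooth_on W g &
        forall i x, W x -> nabla i g x = w i x].
Proof.
move=> Uo Up sw cl.
pose M := \sum_i `|w i p| + \sum_i \sum_j `|nabla i (w j) p| + 1.
have bnd f : smooth_on U f -> `|f p| + 1 <= M -> \forall x \near p, `|f x| <= M.
  move=> sf fM; have := @smooth_continuous R U f p sf Up.
  move/(@cvgrPdist_le _ _ _ (nbhs p) (nbhs_filter p)) => /(_ 1 ltr01) N.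
  apply: (@filterS _ _ (nbhs_filter p) _ _ _ N) => x fx.
  by apply: le_trans fM; have := ler_normB (f p) (f p - f x); rewrite subKr;
    move: fx; lra.
have N1 : \forall x \near p, forall i, `|w i x| <= M.
  apply: (@filter_forall _ _ (fun i x => `|w i x| <= M) _ (nbhs_filter p)) => i;
    apply: bnd => //; rewrite lerD2r (bigD1 i) //=.
  by rewrite -addrA lerDl addr_ge0 ?sumr_ge0 // => j _; rewrite sumr_ge0.
have N2 : \forall x \near p, forall ij : 'I_3 * 'I_3, `|nabla ij.1 (w ij.2) x|
  <= M.
  apply: (@filter_forall _ _ (fun ij x => `|nabla ij.1 (w ij.2) x| <= M) _
    (nbhs_filter p)).
  move=> [i j] /=; apply: bnd; first exact: smooth_on_nabla.
  rewrite lerD2r [X in _ + X](bigD1 i) //= [X in _ + (X + _)](bigD1 j) //=.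
  by rewrite addrCA -addrA lerDl !addr_ge0 ?sumr_ge0 // => l _; exact: sumr_ge0.
have [r /= r0 hr] := (nbhs_ballP _ _).1 (filterI (open_nbhs_nbhs (conj Uo Up))
  (filterI N1 N2)).
have rU : ball p r `<=` U by move=> x /hr[].
have bo : open (ball p r) by exact: ball_open.
have gw i x : ball p r x -> is_derive x (delta_mx 0 i) (potential w p) (w i x).
  apply: (potential_is_derive (M := M) Uo sw cl rU).
  - by move=> j y /hr[_ []].
  - by move=> a b y /hr[_ [_ /(_ (a, b))]].
exists (ball p r), (potential w p); split.
- exact: bo.
- exact: ballxx.
- exact: rU.
- by apply: smooth_on_potential bo _ gw => i; exact: smooth_onW rU (sw i).
- by move=> i x /(gw i); exact: nabla_val.
Qed.
End poincare_lemma.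

Section jets_of_functions.
Context {R : realType}.
Implicit Types (x y : 'rV[R]_3).
Notation e_ i := (delta_mx 0 i : 'rV[R]_3).

(** * Jets of smooth functions *)

Lemma jQ_sym (q : jet (R := R)) i j : symmetric_jet q -> jQ q i j = jQ q j i.
Proof.
move=> [Hs C12 _]; rewrite /jQ; congr (_ - 2 * _).
  by apply: eq_bigr => k _; rewrite C12.
by apply: eq_bigr => k _; rewrite mulrC (Hs k j) (Hs i k).
Qed.

Definition jet_at (f : 'rV[R]_3 -> R) x : jet :=
  Jet (fun i => d1 f i x) (fun i j => d2 f i j x) (fun i j k => d3 f i j k x).

Arguments jet1 : simpl never.
Arguments jet2 : simpl never.
Arguments jet3 : simpl never.

Variable f : 'rV[R]_3 -> R.
Notation q := (jet_at f).

Lemma scalZE x : scalZ f x = jZ (q x).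
Proof.
rewrite /scalZ /jZ /jHpp; congr (_ + _); apply: eq_bigr => i _.
by rewrite mulr_suml; apply: eq_bigr => j _; rewrite mulrAC.
Qed.

Lemma scalXE x : scalX f x = jX (q x).
Proof.
rewrite /scalX /jX expr2; congr (2 * _ - _ + _); apply: eq_bigr => i _.
rewrite mulr_suml; apply: eq_bigr => j _; rewrite mulr_sumr.
by apply: eq_bigr => k _; rewrite !mulrA.
Qed.

Lemma phiE i j x : phi f i j x = jphi (q x) i j.
Proof.
have E a b : \sum_k d1 f a x * d2 f b k x * d1 f k x
    = jet1 (q x) a * jHp (q x) b.
  by rewrite mulr_sumr; apply: eq_bigr => k _; rewrite mulrA.
have -> : phi f i j x = jJ (q x) * jet2 (q x) i j
    - 2 * ((jet1 (q x) i * jHp (q x) j + jet1 (q x) j * jHp (q x) i) / 2)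
    - 1 / 3 * jJ (q x) * jlap (q x) * kron i j + 2 / 3 * jHpp (q x) * kron i j.
  rewrite /phi; congr (_ - 2 * _ - _ + _ * _ * _).
    by congr ((_ + _) / 2); exact: E.
  apply: eq_bigr => k _.
  by rewrite mulr_suml; apply: eq_bigr => l _; rewrite mulrAC.
by rewrite /jphi; move: (q x) => Q; field.
Qed.

Variables (U : set 'rV[R]_3).
Hypotheses (Uo : open U) (sf : smooth_on U f).

Lemma jet_at_sym x : U x -> symmetric_jet (q x).
Proof.
move=> Ux; split=> /=.
- by move=> i j; exact: nabla_nablaC Uo sf Ux.
- by move=> i j k; exact: nabla_nablaC Uo (smooth_on_nabla k sf) Ux.
- move=> i j k; apply: nabla_eq Uo Ux _ => y Uy.
  exact: nabla_nablaC Uo sf Uy.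
Qed.

Section at_point.
Variables (x : 'rV[R]_3).
Hypothesis Ux : U x.
Let Hs i j : jet2 (q x) i j = jet2 (q x) j i.
Proof. by have [] := jet_at_sym Ux. Qed.
Let C12 i j k : jet3 (q x) i j k = jet3 (q x) j i k.
Proof. by have [] := jet_at_sym Ux. Qed.
Let C23 i j k : jet3 (q x) i j k = jet3 (q x) i k j.
Proof. by have [] := jet_at_sym Ux. Qed.

Lemma d_jet1 k i : is_derive x (e_ k) (fun y => jet1 (q y) i) (jet2 (q x) k i).
Proof. exact: smooth_is_derive (smooth_on_nabla i sf) Ux. Qed.

Lemma d_jet2 k i j :
  is_derive x (e_ k) (fun y => jet2 (q y) i j) (jet3 (q x) k i j).
Proof.
exact: smooth_is_derive (smooth_on_nabla i (smooth_on_nabla j sf)) Ux.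
Qed.

Lemma d_jJ k : is_derive x (e_ k) (fun y => jJ (q y)) (jdJ (q x) k).
Proof.
apply: is_derive_eq.
  apply: is_derive_bigsum => i; exact: is_derive_mul (d_jet1 k i) (d_jet1 k i).
by rewrite /jdJ /jHp mulr_sumr; apply: eq_bigr => i _; move: (q x) => Q; ring.
Qed.

Lemma d_jlap k : is_derive x (e_ k) (fun y => jlap (q y)) (jdlap (q x) k).
Proof. by apply: is_derive_bigsum => i; exact: d_jet2. Qed.

Lemma d_jHp k i : is_derive x (e_ k) (fun y => jHp (q y) i) (jdHp (q x) k i).
Proof.
apply: is_derive_eq.
  apply: is_derive_bigsum => j; exact: is_derive_mul (d_jet2 k i j)
    (d_jet1 k j).
by rewrite /jdHp -big_split; apply: eq_bigr => j _ /=; rewrite (Hs i j); move: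
  (q x) => Q; ring.
Qed.

Lemma d_jHpp k : is_derive x (e_ k) (fun y => jHpp (q y)) (jdHpp (q x) k).
Proof.
apply: is_derive_eq.
  apply: is_derive_bigsum => i; exact: is_derive_mul (d_jHp k i) (d_jet1 k i).
by rewrite /jdHpp -big_split; apply: eq_bigr => j _ /=; move: (q x) => Q; ring.
Qed.

Lemma d_jJlap k : is_derive x (e_ k) (fun y => jJ (q y) * jlap (q y))
  (jlap (q x) * jdJ (q x) k + jJ (q x) * jdlap (q x) k).
Proof. exact: is_derive_mul (d_jJ k) (d_jlap k). Qed.

Lemma d_jZ k : is_derive x (e_ k) (fun y => jZ (q y)) (jdZ (q x) k).
Proof. exact: is_derive_add (d_jHpp k) (d_jJlap k). Qed.

Lemma d_jX k : is_derive x (e_ k) (fun y => jX (q y)) (jdX (q x) k).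
Proof.
have dHH : is_derive x (e_ k) (fun y => jHH (q y))
    (2 * \sum_i \sum_j jet3 (q x) k i j * jet2 (q x) i j).
  apply: is_derive_eq.
    apply: is_derive_bigsum => i; apply: is_derive_bigsum => j.
    exact: is_derive_mul (d_jet2 k i j) (d_jet2 k i j).
  rewrite mulr_sumr; apply: eq_bigr => i _; rewrite mulr_sumr.
  by apply: eq_bigr => j _; move: (q x) => Q; ring.
apply: is_derive_eq.
  apply: is_derive_add.
    apply: is_derive_add.
      apply: is_derive_scale; apply: is_derive_bigsum => i.
      exact: is_derive_mul (d_jHp k i) (d_jHp k i).
    exact: is_derive_opp (is_derive_mul (d_jJ k) dHH).
  exact: is_derive_mul (d_jJ k) (is_derive_mul (d_jlap k) (d_jlap k)).
rewrite /jdX; have -> : \sum_i (jHp (q x) i * jdHp (q x) k i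
    + jHp (q x) i * jdHp (q x) k i) = 2 * \sum_i jdHp (q x) k i * jHp (q x) i.
  by rewrite mulr_sumr; apply: eq_bigr => i _; move: (q x) => Q; ring.
by move: (q x) => Q; ring.
Qed.

Lemma d_jphi k i j :
  is_derive x (e_ k) (fun y => jphi (q y) i j) (jdphi (q x) k i j).
Proof.
apply: is_derive_eq.
  apply: is_derive_add; first apply: is_derive_add.
  - exact: is_derive_mul (d_jJ k) (d_jet2 k i j).
  - apply: is_derive_opp; apply: is_derive_add.
      exact: is_derive_mul (d_jet1 k i) (d_jHp k j).
    exact: is_derive_mul (d_jet1 k j) (d_jHp k i).
  - apply: is_derive_mul.
    apply: is_derive_add (is_derive_scale _ (d_jHpp k)) _.
    exact: is_derive_opp (is_derive_scale _ (d_jJlap k)).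
by rewrite /jdphi; move: (q x) => Q; ring.
Qed.

Lemma nabla_J k : nabla k (scalJ f) x = jdJ (q x) k.
Proof. exact: nabla_val (d_jJ k). Qed.

Lemma nabla_Z k : nabla k (scalZ f) x = jdZ (q x) k.
Proof.
rewrite -(nabla_val (d_jZ k)); congr (nabla k _ x); apply/funext => y.
exact: scalZE.
Qed.

Lemma nabla_phi k i j : nabla k (phi f i j) x = jdphi (q x) k i j.
Proof.
rewrite -(nabla_val (d_jphi k i j)); congr (nabla k _ x); apply/funext => y.
exact: phiE.
Qed.

Lemma sigmaE i : sigma f i x = jsigma (q x) i.
Proof. by rewrite /sigma nabla_J nabla_Z scalZE. Qed.

Let jphi_sym i j : jphi (q x) i j = jphi (q x) j i.
Proof. by rewrite /jphi Hs /kron (eq_sym i j); move: (q x) => Q; ring. Qed.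

Let jdphi_sym k i j : jdphi (q x) k i j = jdphi (q x) k j i.
Proof. by rewrite /jdphi (Hs i j) C23 /kron (eq_sym i j); move: (q x) => Q;
  ring. Qed.

Lemma rhoE i j k : rho f i j k x = jrho (q x) i j k.
Proof.
have divE c : \sum_l nabla l (phi f c l) x = jdiv (q x) c.
  by apply: eq_bigr => l _; rewrite nabla_phi jdphi_sym.
have pJE c : \sum_l phi f c l x * nabla l (scalJ f) x = jphidJ (q x) c.
  by apply: eq_bigr => l _; rewrite phiE nabla_J.
by rewrite /rho /jrho /sym3 !nabla_phi !phiE !nabla_J !divE !pJE.
Qed.

Lemma lambdaE j : lambda f j x = jlambda (q x) j.
Proof.
rewrite /lambda /jlambda; congr (_ * _ - _); apply: eq_bigr => i _.
  exact: nabla_phi.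
by rewrite phiE nabla_J jphi_sym.
Qed.

Lemma criterionE : 25 / 14 * scalN f x + 3 / 5 * scalG f x + 3 / 4 * scalF f x
     + 1 / 21 * scalT f x - 17 / 21 * (scalZ f x * scalK f x)
     - 7 / 9 * (scalZ f x * scalA f x) = jE (q x).
Proof.
rewrite /jE scalZE.
have -> : scalA f x = jA (q x) by apply: eq_bigr => i _; rewrite !sigmaE.
have -> : scalK f x = jK (q x).
  by apply: eq_bigr => i _; rewrite sigmaE lambdaE.
have -> : scalT f x = jT (q x).
  apply: eq_bigr => i _; rewrite mulr_suml; apply: eq_bigr => j _.
  by rewrite phiE (sigmaE i) (sigmaE j); move: (q x) => Q; ring.
have -> : scalG f x = jG (q x).
  apply: eq_bigr => i _; rewrite mulr_suml; apply: eq_bigr => j _.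
  by rewrite phiE (lambdaE i) (lambdaE j); move: (q x) => Q; ring.
have -> : scalF f x = jF (q x).
  apply: eq_bigr => i _; apply: eq_bigr => j _; apply: eq_bigr => k _.
  by rewrite rhoE phiE lambdaE; move: (q x) => Q; ring.
have -> // : scalN f x = jN (q x).
apply: eq_bigr => i _; rewrite mulr_suml; apply: eq_bigr => j _.
rewrite mulr_suml; apply: eq_bigr => k _.
by rewrite rhoE phiE sigmaE; move: (q x) => Q; ring.
Qed.

Lemma scalVE eps : scalV f eps x = jV (q x) (eps x).
Proof.
have QE i j : tensQ f i j x = jQ (q x) i j by [].
have Qs i j := jQ_sym i j (jet_at_sym Ux).
rewrite /scalV /jV; congr (_ * _).
apply: eq_bigr => j _; apply: eq_bigr => k _; apply: eq_bigr => l _.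
rewrite -mulrA; congr (_ * (_ * _)); rewrite /jB; congr (_ - _).
by rewrite mulrC; congr (_ * _); apply: eq_bigr => i _; rewrite QE Qs mulrC.
Qed.

Section field.
Variable w : 'I_3 -> 'rV[R]_3 -> R.
Hypothesis sw : forall i, smooth_on U (w i).
Let wx i := w i x.
Let dw k i := nabla k (w i) x.
Let d_w k i : is_derive x (e_ k) (w i) (dw k i).
Proof. exact: smooth_is_derive (sw i) Ux. Qed.

Lemma d_jperp k : is_derive x (e_ k) (fun y => jperp (q y) (fun i => w i y))
  (jdperp (q x) wx dw k).
Proof.
apply: is_derive_eq.
  apply: is_derive_bigsum => i; exact: is_derive_mul (d_jet1 k i) (d_w k i).
by rewrite /jdperp -big_split; apply: eq_bigr => i _; rewrite /wx /=; move:
  (q x) => Q; ring.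
Qed.

Lemma d_jnorm k : is_derive x (e_ k) (fun y => jnorm (q y) (fun i => w i y))
  (2 * jdnorm (q x) wx dw k).
Proof.
apply: is_derive_eq.
  apply: is_derive_add; last exact: is_derive_opp (d_jJ k).
  apply: is_derive_bigsum => i; exact: is_derive_mul (d_w k i) (d_w k i).
rewrite /jdnorm mulrBr; congr (_ - _); rewrite mulr_sumr.
by apply: eq_bigr => i _; rewrite /wx; move: (q x) => Q; ring.
Qed.

Lemma d_jLw k i : is_derive x (e_ k) (fun y => jLw (q y) (fun i => w i y) i)
  (jdLw (q x) wx dw k i).
Proof.
have dHw : is_derive x (e_ k) (fun y => jHw (q y) (fun i => w i y) i)
    (\sum_j jet3 (q x) k i j * wx j + \sum_j dw k j * jet2 (q x) j i).
  apply: is_derive_eq.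
    apply: is_derive_bigsum => j; exact: is_derive_mul (d_jet2 k i j) (d_w k j).
  by rewrite -big_split; apply: eq_bigr => j _; rewrite /wx /= -(Hs i j) /=;
    move: (q x) => Q; ring.
have dHpw : is_derive x (e_ k) (fun y => jHpw (q y) (fun i => w i y))
    (\sum_j jdHp (q x) k j * wx j + \sum_j dw k j * jHp (q x) j).
  apply: is_derive_eq.
    apply: is_derive_bigsum => j; exact: is_derive_mul (d_jHp k j) (d_w k j).
  by rewrite -big_split; apply: eq_bigr => j _; rewrite /wx /=; move: (q x) =>
    Q; ring.
apply: is_derive_eq.
  apply: is_derive_add; first apply: is_derive_add.
  - exact: is_derive_mul (d_jJ k) dHw.
  - apply: is_derive_opp; exact: is_derive_mul dHpw (d_jet1 k i).
  - exact: is_derive_mul (d_jHpp k) (d_w k i).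
by rewrite /jdLw /wx -[jHw (q x) (w^~ x) i]/(jHw (q x) wx i); move: (q x) => Q;
  ring.
Qed.
End field.
End at_point.
End jets_of_functions.

(** * Conjugate functions *)

Section smooth_closure.
Context {R : realType}.
Implicit Types (f g : 'rV[R]_3 -> R) (U : set 'rV[R]_3).

Lemma smooth_on_cst U c : open U -> smooth_on U (fun=> c).
Proof. by move=> Uo; apply/smooth_onP => n; exact: Ck_cst. Qed.

Lemma smooth_on_add U f g : open U -> smooth_on U f -> smooth_on U g ->
  smooth_on U (fun x => f x + g x).
Proof.
by move=> Uo /smooth_onP sf /smooth_onP sg; apply/smooth_onP => n;
  exact: Ck_add.
Qed.

Lemma smooth_on_mul U f g : open U -> smooth_on U f -> smooth_on U g ->
  smooth_on U (fun x => f x * g x).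
Proof.
by move=> Uo /smooth_onP sf /smooth_onP sg; apply/smooth_onP => n;
  exact: Ck_mul.
Qed.

Lemma smooth_on_opp U f : open U -> smooth_on U f -> smooth_on U (fun x =>
  - f x).
Proof. by move=> Uo /smooth_onP sf; apply/smooth_onP => n; exact: Ck_opp. Qed.

Lemma smooth_on_sum U m (f : 'I_m -> 'rV[R]_3 -> R) : open U ->
  (forall i, smooth_on U (f i)) -> smooth_on U (fun x => \sum_i f i x).
Proof.
move=> Uo sf; apply/smooth_onP => n; apply: Ck_sum => // i.
exact: (smooth_onP _ _).1 (sf i) n.
Qed.

Lemma smooth_on_inv_sqrt U f : open U -> smooth_on U f ->
  (forall x, U x -> 0 < f x) -> smooth_on U (fun x => (Num.sqrt (f x))^-1).
Proof.
move=> Uo /smooth_onP sf f0; apply/smooth_onP => n.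
apply: Ck_inv => //; last exact: Ck_sqrt.
by move=> x Ux; rewrite sqrtr_eq0 -ltNge f0.
Qed.
End smooth_closure.

Section nondegenerate.
Context {R : realType}.
Implicit Type q : jet (R := R).

Lemma jJ_ge0 q : 0 <= jJ q.
Proof. by apply: sumr_ge0 => i _; rewrite -expr2 sqr_ge0. Qed.

(** A critical point of f would give Z = 0. *)
Lemma jJ_gt0 q : jZ q != 0 -> 0 < jJ q.
Proof.
move=> Z0; rewrite lt_neqAle jJ_ge0 andbT eq_sym; apply: contra_neq Z0 => J0.
have p0 i : jet1 q i = 0.
  have /eqP := J0; rewrite psumr_eq0 => [/allP/(_ i)|j _]; last first.
    by rewrite -expr2 sqr_ge0.
  by rewrite mem_index_enum -expr2 sqrf_eq0 => /(_ isT)/eqP.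
rewrite /jZ J0 mul0r addr0 /jHpp big1 // => i _; by rewrite p0 mulr0.
Qed.

(** Contract the derivative of p.w = 0 with w and that of w.w = J with p; by
    the symmetry of dw the terms in dw coincide, and H(w,w) = -H(p,p) is left.
    *)
Lemma null_direction q w dw : (forall i j, dw i j = dw j i) ->
  (forall k, jdperp q w dw k = 0) -> (forall k, jdnorm q w dw k = 0) ->
  \sum_i \sum_j jet2 q i j * w i * w j + jHpp q = 0.
Proof.
move=> sym dperp dnorm.
transitivity (\sum_k jdperp q w dw k * w k - \sum_k jdnorm q w dw k * jet1 q k).
  rewrite /jdperp /jdnorm /jHpp !sum3 (sym o1 o0) (sym o2 o0) (sym o2 o1); ring.
by rewrite !big1 ?subrr // => k _; rewrite ?dperp ?dnorm mul0r.
Qed.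
End nondegenerate.

Section conjugate.
Context {R : realType}.
Variables (U : set 'rV[R]_3) (f : 'rV[R]_3 -> R).
Hypotheses (Uo : open U) (sf : smooth_on U f).
Hypothesis X0 : forall x, U x -> jX (jet_at f x) = 0.
Hypothesis Z0 : forall x, U x -> jZ (jet_at f x) != 0.
Notation q := (jet_at f).
Notation e_ i := (delta_mx 0 i : 'rV[R]_3).

Lemma vanishing_derive W (h : 'rV[R]_3 -> R) x v a : open W -> W x ->
  (forall y, W y -> h y = 0) -> is_derive x v h a -> a = 0.
Proof.
move=> Wo Wx h0 [_ <-].
by rewrite (near_eq_derive v (open_near Wo Wx h0)) derive_cst.
Qed.

Lemma jdX_eq0 x k : U x -> jdX (q x) k = 0.
Proof. by move=> Ux; exact: (vanishing_derive (h := fun y => jX (q y)) Uo Ux X0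
  (d_jX Uo sf Ux k)). Qed.

Section field.
Variables (W : set 'rV[R]_3) (w : 'I_3 -> 'rV[R]_3 -> R).
Hypotheses (Wo : open W) (WU : W `<=` U) (sw : forall i, smooth_on W (w i)).
Hypothesis perp : forall x, W x -> jperp (q x) (w^~ x) = 0.
Hypothesis wnorm : forall x, W x -> jnorm (q x) (w^~ x) = 0.
Let sfW : smooth_on W f := smooth_onW WU sf.

Lemma jdperp_eq0 x k : W x -> jdperp (q x) (w^~ x) (fun i j => nabla i
  (w j) x) k = 0.
Proof.
by move=> Wx; exact: (vanishing_derive (h := fun y => jperp (q y)
  (w^~ y)) Wo Wx perp
  (d_jperp sfW Wx sw k)).
Qed.

Lemma jdnorm_eq0 x k : W x -> jdnorm (q x) (w^~ x) (fun i j => nabla i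
  (w j) x) k = 0.
Proof.
move=> Wx; have := vanishing_derive (h := fun y => jnorm (q y)
  (w^~ y)) Wo Wx wnorm
  (d_jnorm sfW Wx sw k).
by move/eqP; rewrite mulf_eq0 pnatr_eq0 => /eqP.
Qed.

Lemma closed_iff_at (eps : 'I_3 -> 'I_3 -> 'I_3 -> R) x :
  (forall y i, W y -> jLw (q y) (w^~ y) i = 0) -> W x ->
  (forall i j k, eps j i k = - eps i j k) ->
  (forall i j k, eps i k j = - eps i j k) ->
  \sum_i \sum_j \sum_k eps i j k * eps i j k = 6 ->
  (forall i j, nabla i (w j) x = nabla j (w i) x) <->
  jV (q x) eps = 0 /\ jE (q x) = 0.
Proof.
move=> Lw Wx e12 e23 e6; have Ux := WU Wx.
have ker : kernel_field (q x) (w^~ x) (fun i j => nabla i (w j) x).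
  split.
  - exact: (jet_at_sym Uo sf Ux).
  - move=> i; exact: (Lw x i Wx).
  - move=> k; exact: (jdperp_eq0 k Wx).
  - move=> k; exact: (jdnorm_eq0 k Wx).
  - move=> k i; refine (vanishing_derive (h := fun y => jLw (q y) (w^~ y) i)
      Wo Wx _ (d_jLw Wo sfW Wx sw k i)) => y; exact: Lw.
exact (closed_iff ker (jJ_gt0 (Z0 Ux)) (Z0 Ux) (fun k => jdX_eq0 k Ux) (perp Wx)
  (wnorm Wx) e12 e23 e6).
Qed.
End field.
End conjugate.

Section criterion.
Context {R : realType}.
Variables (U : set 'rV[R]_3) (f : 'rV[R]_3 -> R).
Hypotheses (Uo : open U) (sf : smooth_on U f).
Hypothesis X0 : forall x, U x -> jX (jet_at f x) = 0.
Hypothesis Z0 : forall x, U x -> jZ (jet_at f x) != 0.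
Notation q := (jet_at f).
Variable eps : 'rV[R]_3 -> 'I_3 -> 'I_3 -> 'I_3 -> R.
Hypothesis heps : normalised_volume_form eps.

Lemma dotE (u v : 'I_3 -> R) : dot (\row_i u i) (\row_i v i) = \sum_i u i * v i.
Proof. by apply: eq_bigr => i _; rewrite !mxE. Qed.

(** The gradient of a conjugate satisfies jL w = 0, and is closed. *)
Lemma conjugate_necessary : locally_has_smooth_conjugate U f ->
  forall x, U x -> jV (q x) (eps x) = 0 /\ jE (q x) = 0.
Proof.
move=> hf x Ux; have [W [g [Wo Wx WU sg conj]]] := hf x Ux.
have [_ e12 e23 e6] := heps.
have sw i : smooth_on W (nabla i g) by exact: smooth_on_nabla.
have perp y : W y -> jperp (q y) (fun i => nabla i g y) = 0.
  by move=> /conj[_]; rewrite dotE.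
have wnorm y : W y -> jnorm (q y) (fun i => nabla i g y) = 0.
  move=> /conj[+ _]; rewrite /enorm !dotE => /eqP.
  rewrite eqr_sqrt ?sumr_ge0 // => [/eqP e|i _|i _];
    rewrite -?expr2 ?sqr_ge0 //.
  by rewrite /jnorm -e subrr.
have sym y i j : W y -> nabla i (nabla j g) y = nabla j (nabla i g) y.
  exact: nabla_nablaC Wo sg.
have Lw y i : W y -> jLw (q y) (fun j => nabla j g y) i = 0.
  move=> Wy; have Uy := WU _ Wy; have [Hs _ _] := jet_at_sym Uo sf Uy.
  apply: (jLw_eq0 Hs (X0 Uy) (perp _ Wy) (wnorm _ Wy)).
  apply: (null_direction (dw := fun i j => nabla i (nabla j g) y)).
  - move=> a b; exact: sym.
  - move=> k; exact: (jdperp_eq0 sf Wo WU sw perp).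
  - move=> k; exact: (jdnorm_eq0 sf Wo WU sw wnorm).
exact ((closed_iff_at Uo sf X0 Z0 Wo WU sw perp wnorm Lw Wx (e12 x) (e23 x)
  (e6 x)).1 (fun i j => sym x i j Wx)).
Qed.

Lemma smooth_jproj i k : smooth_on U (fun x => jproj (q x) i k) /\
  smooth_on U (fun x => jZ (q x)).
Proof.
have A g h := @smooth_on_add R U g h Uo; have M g h :=
  @smooth_on_mul R U g h Uo.
have N g := @smooth_on_opp R U g Uo; have S m g := @smooth_on_sum R U m g Uo.
have c0 (c : R) : smooth_on U (fun=> c) by exact: smooth_on_cst.
have s1 j : smooth_on U (fun x => jet1 (q x) j) by exact:
  (smooth_on_nabla j sf).
have s2 j l : smooth_on U (fun x => jet2 (q x) j l).
  exact: (smooth_on_nabla j (smooth_on_nabla l sf)).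
have sJ : smooth_on U (fun x => jJ (q x)) :=
  S _ _ (fun j => M _ _ (s1 j) (s1 j)).
have sHp j : smooth_on U (fun x => jHp (q x) j) :=
  S _ _ (fun l => M _ _ (s2 j l) (s1 l)).
have sHpp : smooth_on U (fun x => jHpp (q x)) :=
  S _ _ (fun l => M _ _ (sHp l) (s1 l)).
have slap : smooth_on U (fun x => jlap (q x)) := S _ _ (fun l => s2 l l).
have sZ : smooth_on U (fun x => jZ (q x)) := A _ _ sHpp (M _ _ sJ slap).
have sL : smooth_on U (fun x => jL (q x) i k) :=
  (A _ _ (A _ _ (A _ _ (M _ _ sJ (s2 i k)) (N _ (M _ _ (s1 i) (sHp k))))
    (N _ (M _ _ (sHp i) (s1 k)))) (M _ _ sHpp (c0 (kron i k)))).
split; last exact sZ.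
exact (A _ _ (M _ _ sJ (A _ _ (M _ _ sZ (c0 (kron i k))) (N _ sL)))
  (N _ (M _ _ (M _ _ sZ (s1 i)) (s1 k)))).
Qed.

(** Near p a column of the projection onto the null line does not vanish;
    scaled to the length of the gradient of f it is closed by the pointwise
    criterion, and its potential is a conjugate. *)
Lemma conjugate_sufficient :
  (forall x, U x -> jV (q x) (eps x) = 0 /\ jE (q x) = 0) ->
  locally_has_smooth_conjugate U f.
Proof.
move=> VE p Up; have [_ e12 e23 e6] := heps.
have Hs y : U y -> forall i j, jet2 (q y) i j = jet2 (q y) j i.
  by move=> Uy; have [] := jet_at_sym Uo sf Uy.
have [k kp] := jproj_gt0 (jJ_gt0 (Z0 Up)) (Z0 Up).
pose h y := jZ (q y) * jproj (q y) k k.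
have sh : smooth_on U h.
  exact (smooth_on_mul Uo (smooth_jproj k k).2 (smooth_jproj k k).1).
pose W := U `&` [set y | 0 < h y].
have WU : W `<=` U by move=> y [].
have Wo : open W.
  rewrite openE => y [Uy hy]; apply: filterI; first exact: open_nbhs_nbhs.
  have := smooth_continuous sh Uy; move/(@cvgr_gt _ _ _ (nbhs_filter y)).
  by move=> /(_ 0 hy).
have Wp : W p by split.
pose w i y := jkernel (q y) k i.
have sw i : smooth_on W (w i).
  apply: (smooth_on_mul Wo).
    exact (smooth_onW WU (smooth_jproj i k).1).
  by apply: (smooth_on_inv_sqrt Wo (smooth_onW WU sh)) => y [].
have perp y : W y -> jperp (q y) (w^~ y) = 0.
  by move=> /WU Uy; exact: (jkernel_perp (Hs y Uy)).
have wnorm y : W y -> jnorm (q y) (w^~ y) = 0.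
  by move=> [Uy hy]; exact: (jkernel_norm (Hs y Uy) (X0 Uy) hy).
have Lw y i : W y -> jLw (q y) (w^~ y) i = 0.
  by move=> /WU Uy; exact: (jkernel_Lw (Hs y Uy) (X0 Uy)).
have closed i j y : W y -> nabla i (w j) y = nabla j (w i) y.
  move=> Wy; exact ((closed_iff_at Uo sf X0 Z0 Wo WU sw perp wnorm Lw Wy (e12 y)
    (e23 y) (e6 y)).2 (VE y (WU y Wy)) i j).
have [V [g [Vo Vp VW sg gw]]] := poincare Wo Wp sw closed.
exists V, g; split=> //; first by move=> y /VW/WU.
move=> y Vy; have Wy := VW _ Vy; split.
  rewrite /enorm; congr (Num.sqrt _); rewrite !dotE.
  have /eqP := wnorm y Wy; rewrite subr_eq0 => /eqP e.
  transitivity (\sum_i w i y * w i y); first exact: esym e.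
  by apply: eq_bigr => i _; rewrite gw.
rewrite dotE; transitivity (jperp (q y) (w^~ y)); last exact: perp.
by apply: eq_bigr => i _; rewrite gw.
Qed.
End criterion.

Theorem corollary10 (R : realType)
    (eps : 'rV[R]_3 -> 'I_3 -> 'I_3 -> 'I_3 -> R)
    (U : set 'rV[R]_3) (f : 'rV[R]_3 -> R)
    (heps : normalised_volume_form eps)
    (hU : open U) (hf : smooth_on U f)
    (hX : forall x, U x -> scalX f x = 0)
    (hY : forall x, U x -> 0 < scalY f x) :
  locally_has_smooth_conjugate U f <->
  (forall x, U x -> scalV f eps x = 0) /\
  (forall x, U x ->
     25 / 14 * scalN f x + 3 / 5 * scalG f x + 3 / 4 * scalF f x
     + 1 / 21 * scalT f x - 17 / 21 * (scalZ f x * scalK f x)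
     - 7 / 9 * (scalZ f x * scalA f x) = 0).
Proof.
have X0 x : U x -> jX (jet_at f x) = 0 by move=> Ux; rewrite -scalXE hX.
have Z0 x : U x -> jZ (jet_at f x) != 0.
  move=> Ux; have := hY x Ux; rewrite /scalY hX // mulr0 subr0 scalZE.
  by apply: contraTneq => ->; rewrite expr0n ltxx.
split=> [conj|[V0 E0]].
  have VE := conjugate_necessary hU hf X0 Z0 heps conj.
  split=> x Ux; have [V0 E0] := VE x Ux.
    by rewrite (scalVE hU hf Ux).
  by rewrite (criterionE hU hf Ux).
apply: (conjugate_sufficient hU hf X0 Z0 heps) => x Ux; split.
  by rewrite -(scalVE hU hf Ux) V0.
by rewrite -(criterionE hU hf Ux) E0.
Qed.
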